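(* Let $\mu$ be a balanced Borel measure on $\mathbb{R}^n$, and let $1<q<\infty$ and $\alpha>0$. Let $T=T^{r,s}$ be a Haar shift operator of complexity $(r,s)$ (defined with respect to $\mu$) which is bounded on $L^2(\mu)$. Then there is a constant $C<\infty$, independent of $f$, such that $$\|Tf\|_{\Lambda_q(\alpha)}\le C\,\|f\|_{\Lambda_q(\alpha)}\qquad\text{for all } f\in\Lambda_q(\alpha).$$
   Context: Dyadic system. $\mathcal{D}=\bigcup_{k\in\mathbb{Z}}\mathcal{D}_k$ is a fixed dyadic system on $\mathbb{R}^n$: each $\mathcal{D}_k$ is a partition of $\mathbb{R}^n$ into half-open cubes with sides parallel to the axes and side length $2^{-k}$, and any two cubes of $\mathcal{D}$ are either disjoint or nested. For an integer $r\ge 0$ and $Q\in\mathcal{D}$, $\mathcal{D}_r(Q)$ is the family of $R\in\mathcal{D}$ with $R\subset Q$ and $\ell(Q)=2^r\ell(R)$, where $\ell$ denotes side length. $\widehat Q$ is the dyadic parent of $Q$ and $Q^{(N)}$ its $N$-th dyadic ancestor. Measure. $\mu$ is a Borel measure with $0<\mu(Q)<\infty$ for all $Q\in\mathcal{D}$ and $\lim_{N\to\infty}\mu(Q^{(N)})=\infty$ for all $Q\in\mathcal{D}$ (every dyadic quadrant has infinite measure). Write $\langle f\rangle_Q=\mu(Q)^{-1}\int_Q f\,d\mu$ and $\langle f,g\rangle=\int fg\,d\mu$. Haar functions. A Haar system $\{h_Q^j\}_{Q\in\mathcal{D},\,1\le j<2^n}$ is fixed: $h_Q^j$ is supported on $Q$,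 is constant on each $R\in\mathcal{D}_1(Q)$, satisfies $\int h_Q^j\,d\mu=0$, and the whole family is an orthonormal basis of $L^2(\mu)$. Balanced. $\mu$ is balanced if $$\sup_{Q\in\mathcal{D}}\ \sup_{R\in\mathcal{D}_1(Q)}\ \Big[\|h_Q^{j}\|_{L^1(\mu)}\|h_R^{j'}\|_{L^\infty(\mu)}+\|h_Q^{j}\|_{L^\infty(\mu)}\|h_R^{j'}\|_{L^1(\mu)}\Big]<\infty ,$$ the supremum being taken also over all indices $j,j'$. Haar shifts. A (cancellative) Haar shift operator of complexity $(r,s)$, with $r,s$ nonnegative integers, is an operator of the form $$T^{r,s}f(x)=\sum_{Q\in\mathcal{D}}\ \sum_{R\in\mathcal{D}_r(Q),\,S\in\mathcal{D}_s(Q)}\ \sum_{j,j'}\alpha^Q_{R,S}\,\langle f,h_R^j\rangle\,h_S^{j'}(x)$$ with scalar coefficients $\alpha^Q_{R,S}$. It is known (López-Sánchez, Martell, Parcet) that for balanced $\mu$ an $L^2(\mu)$-bounded Haar shift extends boundedly to $L^q(\mu)$ for $1<q<\infty$. Martingale Lipschitz spaces. $\Lambda_q(\alpha)$ is the space of $f\in L^q_{\mathrm{loc}}(\mu)$ with $$\|f\|_{\Lambda_q(\alpha)}=\sup_{Q\in\mathcal{D}}\frac{1}{\mu(Q)^{1/q+\alpha}}\Big(\int_Q|f-\langle f\rangle_{\widehat Q}|^q\,d\mu\Big)^{1/q}<\infty.$$ This seminorm vanishes on functions constant on each dyadic quadrant. Meaning of $Tf$ for $f\in\Lambda_q(\alpha)$: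 $Tf$ is the function, determined up to adding a function constant on each dyadic quadrant, such that for every $Q_0\in\mathcal{D}$ the difference $Tf-T\big(f\mathbf{1}_{Q_0^{(r+s)}}\big)$ is $\mu$-a.e. constant on $Q_0$. *)

(* Defs.v *)
From HB Require Import structures.
From mathcomp Require Import all_boot all_order all_algebra.
From mathcomp Require Import all_classical all_reals all_analysis.

Set Implicit Arguments.
Unset Strict Implicit.
Unset Printing Implicit Defensive.

Import Order.TTheory GRing.Theory Num.Theory.
Import numFieldNormedType.Exports.

Local Open Scope classical_set_scope.
Local Open Scope ring_scope.

(* R^n is [n.-tuple R]; its library sigma-algebra, the product of the Borel
   sigma-algebras of the factors, is the Borel sigma-algebra of R^n. *)

Definition cube (R : realType) (n : nat) (a : n.-tuple R) (l : R) :
    set (n.-tuple R) :=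
  [set x | forall i, tnth a i <= tnth x i < tnth a i + l].

Record dyadic_system (R : realType) (n : nat)
    (D : int -> set (set (n.-tuple R))) : Prop := {
  dyadic_cube : forall k Q, D k Q -> exists a, Q = cube a (2 ^ (- k)) ;
  dyadic_partition : forall k, partition (D k) id [set: n.-tuple R] ;
  dyadic_nested : forall k l P Q, D k P -> D l Q ->
    [\/ P `&` Q = set0, P `<=` Q | Q `<=` P] }.

Definition dyadic (R : realType) (n : nat)
    (D : int -> set (set (n.-tuple R))) : set (set (n.-tuple R)) :=
  \bigcup_(k in [set: int]) D k.

(* D_r(Q).  For 0 < n a cube determines its generation, so that the condition
   on the generations is l(Q) = 2^r l(P). *)
Definition descendants (R : realType) (n : nat)
    (D : int -> set (set (n.-tuple R))) (r : nat) (Q : set (n.-tuple R)) :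
    set (set (n.-tuple R)) :=
  [set P | [/\ exists2 k, D k Q & D (k + r%:Z) P & P `<=` Q]].

Definition ancestor (R : realType) (n : nat)
    (D : int -> set (set (n.-tuple R))) (N : nat) (Q : set (n.-tuple R)) :
    set (n.-tuple R) :=
  xget set0 [set P | descendants D N P Q].

Definition parent (R : realType) (n : nat)
    (D : int -> set (set (n.-tuple R))) (Q : set (n.-tuple R)) :
    set (n.-tuple R) :=
  ancestor D 1 Q.

Record dyadic_measure (R : realType) (n : nat)
    (D : int -> set (set (n.-tuple R)))
    (mu : {measure set (n.-tuple R) -> \bar R}) : Prop := {
  dyadic_measure_gt0 : forall Q, dyadic D Q -> (0 < mu Q)%E ;
  dyadic_measure_fin : forall Q, dyadic D Q -> (mu Q < +oo)%E ;
  dyadic_measure_quadrant : forall Q, dyadic D Q ->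
    mu (ancestor D N Q) @[N --> \oo] --> +oo%E }.

Definition average (R : realType) (n : nat)
    (mu : {measure set (n.-tuple R) -> \bar R}) (Q : set (n.-tuple R))
    (f : n.-tuple R -> R) : R :=
  (fine (mu Q))^-1 * \int[mu]_(x in Q) f x.

Definition inner (R : realType) (n : nat)
    (mu : {measure set (n.-tuple R) -> \bar R})
    (f g : n.-tuple R -> R) : R :=
  \int[mu]_x (f x * g x).

(* The 2^n - 1 indices 1 <= j < 2^n are numbered from 0. *)
Definition haar_family (R : realType) (n : nat) : Type :=
  set (n.-tuple R) -> 'I_(2 ^ n).-1 -> n.-tuple R -> R.

Record haar_system (R : realType) (n : nat)
    (D : int -> set (set (n.-tuple R)))
    (mu : {measure set (n.-tuple R) -> \bar R})
    (h : haar_family R n) : Prop := {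
  haar_support : forall Q j x, dyadic D Q -> ~ Q x -> h Q j x = 0 ;
  haar_const : forall Q P j x y, dyadic D Q -> descendants D 1 Q P ->
    P x -> P y -> h Q j x = h Q j y ;
  haar_cancel : forall Q j, dyadic D Q -> \int[mu]_x h Q j x = 0 ;
  haar_orthonormal : forall Q Q' j j', dyadic D Q -> dyadic D Q' ->
    inner mu (h Q j) (h Q' j') = ((Q == Q') && (j == j'))%:R;
  haar_dense : forall f, f \in Lfun mu 2%:E -> forall e : R, 0 < e ->
    exists (s : seq (set (n.-tuple R) * 'I_(2 ^ n).-1))
           (c : set (n.-tuple R) * 'I_(2 ^ n).-1 -> R),
      (forall p, p \in s -> dyadic D p.1) /\
      ('N[mu]_2%:E[EFin \o (fun x => f x - \sum_(p <- s) c p * h p.1 p.2 x)%R]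
        < e%:E)%E }.

Definition balanced (R : realType) (n : nat)
    (D : int -> set (set (n.-tuple R)))
    (mu : {measure set (n.-tuple R) -> \bar R})
    (h : haar_family R n) : Prop :=
  (ereal_sup [set z | exists Q P j j',
     [/\ dyadic D Q, descendants D 1 Q P &
         z = 'N[mu]_1[EFin \o h Q j] * 'N[mu]_+oo[EFin \o h P j'] +
             'N[mu]_+oo[EFin \o h Q j] * 'N[mu]_1[EFin \o h P j']]]
   < +oo)%E.

(* The part of the shift carried by the cubes of generation k.  Every sum is
   finite: at a point x only the cube of D k containing x contributes. *)
Definition haar_shift_gen (R : realType) (n : nat)
    (D : int -> set (set (n.-tuple R)))
    (mu : {measure set (n.-tuple R) -> \bar R}) (h : haar_family R n)
    (r s : nat)
    (a : set (n.-tuple R) -> set (n.-tuple R) -> set (n.-tuple R) -> R)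
    (f : n.-tuple R -> R) (x : n.-tuple R) (k : int) : R :=
  \sum_(Q \in D k)
    \sum_(P \in descendants D r Q) \sum_(S \in descendants D s Q)
      \sum_j \sum_j' a Q P S * inner mu f (h P j) * h S j' x.

Definition haar_shift_cvg (R : realType) (n : nat)
    (D : int -> set (set (n.-tuple R)))
    (mu : {measure set (n.-tuple R) -> \bar R}) (h : haar_family R n)
    (r s : nat)
    (a : set (n.-tuple R) -> set (n.-tuple R) -> set (n.-tuple R) -> R)
    (f : n.-tuple R -> R) (x : n.-tuple R) : Prop :=
  cvgn (series (fun i : nat => haar_shift_gen D mu h r s a f x i%:Z)) /\
  cvgn (series (fun i : nat => haar_shift_gen D mu h r s a f x (- i.+1%:Z))).

(* The sum over Q in D defining T f at x, as a two-sided series over the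
   generations.  When T is bounded on L^2 it converges almost everywhere to the
   L^2-sum for f in L^2 (martingale convergence), and for balanced mu also to
   the bounded extension of T for f in L^q, 1 < q < oo. *)
Definition haar_shift (R : realType) (n : nat)
    (D : int -> set (set (n.-tuple R)))
    (mu : {measure set (n.-tuple R) -> \bar R}) (h : haar_family R n)
    (r s : nat)
    (a : set (n.-tuple R) -> set (n.-tuple R) -> set (n.-tuple R) -> R)
    (f : n.-tuple R -> R) (x : n.-tuple R) : R :=
  limn (series (fun i : nat => haar_shift_gen D mu h r s a f x i%:Z)) +
  limn (series (fun i : nat => haar_shift_gen D mu h r s a f x (- i.+1%:Z))).

Definition L2_bounded (R : realType) (n : nat)
    (mu : {measure set (n.-tuple R) -> \bar R})
    (T : (n.-tuple R -> R) -> n.-tuple R -> R) : Prop :=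
  exists C : R, forall f, f \in Lfun mu 2%:E ->
    ('N[mu]_2%:E[EFin \o T f] <= C%:E * 'N[mu]_2%:E[EFin \o f])%E.

Definition Lq_loc (R : realType) (n : nat)
    (mu : {measure set (n.-tuple R) -> \bar R}) (q : R)
    (f : n.-tuple R -> R) : Prop :=
  measurable_fun [set: n.-tuple R] f /\
  forall M : R,
    (\int[mu]_(x in [set x : n.-tuple R | forall i, `|tnth x i| <= M]%R)
       (`|f x| `^ q)%:E < +oo)%E.

Definition lipschitz_norm (R : realType) (n : nat)
    (D : int -> set (set (n.-tuple R)))
    (mu : {measure set (n.-tuple R) -> \bar R}) (q alpha : R)
    (f : n.-tuple R -> R) : \bar R :=
  ereal_sup [set
    (((fine (mu Q) `^ (q^-1 + alpha))^-1)%:E *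
     (\int[mu]_(x in Q) (`|f x - average mu (parent D Q) f| `^ q)%:E)
       `^ q^-1)%E | Q in dyadic D].

Definition lipschitz_space (R : realType) (n : nat)
    (D : int -> set (set (n.-tuple R)))
    (mu : {measure set (n.-tuple R) -> \bar R}) (q alpha : R) :
    set (n.-tuple R -> R) :=
  [set f | Lq_loc mu q f /\ (lipschitz_norm D mu q alpha f < +oo)%E].

(* F is a version of T f for f locally in L^q: on each Q0 in D it differs from
   T (f 1_(Q0^(r+s))) by an a.e. constant. *)
Definition haar_shift_image (R : realType) (n : nat)
    (D : int -> set (set (n.-tuple R)))
    (mu : {measure set (n.-tuple R) -> \bar R}) (h : haar_family R n)
    (r s : nat)
    (a : set (n.-tuple R) -> set (n.-tuple R) -> set (n.-tuple R) -> R)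
    (f F : n.-tuple R -> R) : Prop :=
  measurable_fun [set: n.-tuple R] F /\
  forall Q0, dyadic D Q0 ->
    let f0 := f \* \1_(ancestor D (r + s) Q0) in
    exists c : R, {ae mu, forall x, Q0 x ->
      haar_shift_cvg D mu h r s a f0 x /\
      F x - haar_shift D mu h r s a f0 x = c}.

(* Main.v *)
Require Import Defs.
From HB Require Import structures.
From mathcomp Require Import all_boot all_order all_algebra.
From mathcomp Require Import finmap.
From mathcomp Require Import all_classical all_reals all_analysis.
From mathcomp Require Import measurable_realfun ess_sup_inf.
From mathcomp Require Import zify ring lra.

Set Implicit Arguments.
Unset Strict Implicit.
Unset Printing Implicit Defensive.

Import Order.TTheory GRing.Theory Num.Theory.
Import numFieldNormedType.Exports.

Local Open Scope classical_set_scope.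
Local Open Scope ring_scope.

(** The seminorm only sees the martingale differences of f, and so does every
    term of a Haar shift.  The exponent alpha > 0 makes all sums of these
    differences converge absolutely and pointwise, with bounds that depend on T
    through the size of its coefficients; boundedness on L^2, tested on single
    Haar functions, bounds the coefficients ([coefficients_bounded]).

    Self-improvement of jumps.  If f has seminorm at most N, then the jump
    d_R = <f>_R - <f>_Q from a cube Q to a child R is at most 2 N mu(R)^alpha
    ([lipschitz_jumps]).  The jumps on the children of Q have mu-weighted sum
    zero, so the jump on a heavy child is controlled by those on its light
    siblings.  This improves the bound in two ways.  Up to constants d_R is at
    most mu(Q)^alpha - mu(R)^alpha ([mean_zero_telescopes]), which telescopes
    along a decreasing chain of cubes although mu(R) / mu(Q) may stay close
    to 1; and it is at most m_R^alpha, where m_R = mu(R) (1 - mu(R) / mu(Q)) is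
    comparable to the smaller one of mu(R) and mu(Q \ R)
    ([mean_zero_harmonic]).

    What balancedness says.  Since the Haar functions of Q and the constants
    span the functions constant on the children of Q, the sum over j of
    h_Q^j(R)^2 is 1 / mu(R) - 1 / mu(Q) ([hval_parseval]).  Hence the L^1 norms
    of the h_P^j see m_R for every child R of P, and the supremum norms of the
    h_S^j see m_R' / mu(R')^2 for every child R' of S.  Iterating the balance
    condition over a bounded number of generations bounds the product of these
    norms, and it follows that m_R is at most a constant times mu(R'), for all
    children R of P and R' of S ([masses_comparable]).  Together with the second
    bound on jumps, <f, h_P^j> h_S^j' is O(N mu(R')^alpha) on R'
    ([haar_coefficient_le]).

    Fine and coarse scales.  The terms of T f with output cube S thus satisfy on
    the children of S the bound that the jumps of f satisfy, and they have mean
    zero on S, so they telescope in turn ([gen_le], [gen_telescopes]).  On a cube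
    Q, T applied to the restriction of f to an ancestor of Q is a constant plus
    the sum of the terms with output cube inside Q, the fine part
    ([haar_shift_fine]).  The remaining terms are constant on Q and are summable
    because Parseval bounds them by differences of 1 / mu along the ancestors of
    Q ([gen_localize_le]).  A version of T f is obtained by subtracting from the
    coarse terms their value at one point of each quadrant
    ([haar_shift_image_exists]).  Finally the fine part has mean zero on Q and is
    O(N mu(R)^alpha) on each child R of Q, which is the estimate required by the
    seminorm ([lipschitz_of_decomposition]). *)

(** * Geometry of dyadic cubes *)

Section cubes.
Context {R : realType} {n : nat}.
Implicit Types (a b : n.-tuple R) (l m : R).

Lemma cube_corner a l : 0 < l -> cube a l a.
Proof. by move=> l0 i; rewrite lexx ltrDl. Qed.

Lemma cube_side_le a b l m : (0 < n)%N -> 0 < l -> cube a l `<=` cube b m ->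
  l <= m.
Proof.
move=> n0 l0 ab; rewrite leNgt; apply/negP => ml.
have ca := ab _ (cube_corner a l0).
pose i0 := Ordinal n0.
have m0 : 0 < m by have /andP[h1 h2] := ca i0; lra.
pose c := [tuple tnth a i + m | i < n].
have /ab/(_ i0) : cube a l c by move=> i; rewrite tnth_mktuple; lra.
have := ca i0.
by rewrite /c tnth_mktuple; lra.
Qed.

Lemma cube_meet a b l : (forall i, `|tnth a i - tnth b i| < l) ->
  cube a l `&` cube b l !=set0.
Proof.
move=> ab; exists [tuple Num.max (tnth a i) (tnth b i) | i < n].
split=> i; rewrite tnth_mktuple; have := ab i;
  by case: (lerP (tnth a i) (tnth b i)) => ?; lra.
Qed.

Lemma measurable_cube a l : measurable (cube a l).
Proof.
have -> : cube a l = \bigcap_(i in [set` 'I_n])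
    ((@tnth n R ^~ i) @^-1` `[tnth a i, tnth a i + l[%classic).
  apply/seteqP; split=> x /= h i.
    by move=> _ /=; rewrite in_itv /=; exact: h.
  by have := h i isT; rewrite /= in_itv.
apply: fin_bigcap_measurable => // i _.
by rewrite -[X in measurable X]setTI; apply: measurable_tnth.
Qed.

End cubes.

Section cells.
Context {R : realType} {n : nat} (n_gt0 : (0 < n)%N).
Context (D : int -> set (set (n.-tuple R))) (D_dyadic : dyadic_system D).
Implicit Types (x y : n.-tuple R) (k l : int) (P Q : set (n.-tuple R)).

Definition cell k x : set (n.-tuple R) :=
  xget set0 [set Q | D k Q /\ Q x].

Lemma cellP k x : D k (cell k x) /\ cell k x x.
Proof.
have [cov _ _] := dyadic_partition D_dyadic k.
have : [set: n.-tuple R] x by [].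
rewrite -cov => -[Q DQ Qx].
exact: (@xgetI _ set0 [set Q | D k Q /\ Q x] Q).
Qed.

Lemma D_cell k x : D k (cell k x). Proof. by case: (cellP k x). Qed.

Lemma in_cell k x : cell k x x. Proof. by case: (cellP k x). Qed.

Lemma dyadic_cell k x : dyadic D (cell k x).
Proof. by exists k => //; exact: D_cell. Qed.

Lemma cell_unique k Q x : D k Q -> Q x -> Q = cell k x.
Proof.
move=> DQ Qx; have [_ triv _] := dyadic_partition D_dyadic k.
by apply: triv => //; [exact: D_cell | exists x; split => //; exact: in_cell].
Qed.

Lemma cell_eq k x y : cell k x y -> cell k y = cell k x.
Proof. by move=> xy; apply/esym/cell_unique => //; exact: D_cell. Qed.

Lemma cell_ofP k Q : D k Q -> exists x, Q = cell k x.
Proof.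
move=> DQ; have [_ _ /(_ _ DQ) [x Qx]] := dyadic_partition D_dyadic k.
by exists x; exact: cell_unique.
Qed.

Lemma side_gt0 k : 0 < (2 : R) ^ k. Proof. by rewrite exprz_gt0. Qed.

Lemma side_lt k l : k < l -> (2 : R) ^ (- l) < 2 ^ (- k).
Proof. by move=> kl; rewrite ltr_eXz2l ?ltrN2// ltr1n. Qed.

Lemma cell_sub k l x : k <= l -> cell l x `<=` cell k x.
Proof.
rewrite le_eqVlt => /orP[/eqP -> //|kl].
have [] := dyadic_nested D_dyadic (D_cell l x) (D_cell k x) => //.
- move=> E; exfalso; suff: (cell l x `&` cell k x) x by rewrite E.
  by split; exact: in_cell.
- move=> kl'; exfalso; move: kl'.
  have [a ->] := dyadic_cube D_dyadic (D_cell k x).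
  have [b ->] := dyadic_cube D_dyadic (D_cell l x).
  by move/(cube_side_le n_gt0 (side_gt0 _)); rewrite leNgt side_lt.
Qed.

Lemma cell_eq_le k l x y : k <= l -> cell l x y -> cell k y = cell k x.
Proof. by move=> kl xy; apply: cell_eq; apply: (cell_sub kl). Qed.

Lemma cell_gen k l x y : cell k x = cell l y -> k = l.
Proof.
have main k' l' x' y' : cell k' x' = cell l' y' -> k' <= l'.
  move=> E; rewrite leNgt; apply/negP => lk.
  have : cell l' y' `<=` cell k' x' by rewrite E.
  have [a ->] := dyadic_cube D_dyadic (D_cell k' x').
  have [b ->] := dyadic_cube D_dyadic (D_cell l' y').
  by move/(cube_side_le n_gt0 (side_gt0 _)); rewrite leNgt side_lt.
move=> E; apply/eqP; rewrite eq_le (main _ _ _ _ E) /=.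
exact: main (esym E).
Qed.

Lemma descendantsP (r : nat) k x P :
  descendants D r (cell k x) P <-> exists2 y, cell k x y & P = cell (k + r%:Z) y.
Proof.
split=> [[[l Dl Dlr] PQ]|[y xy ->]].
  have [z zE] := cell_ofP Dl; have [y PE] := cell_ofP Dlr.
  have kl := cell_gen zE; rewrite -kl in PE.
  by exists y => //; apply: PQ; rewrite PE; exact: in_cell.
split; first by exists k; exact: D_cell.
by rewrite -(cell_eq xy); apply: cell_sub; lia.
Qed.

Lemma ancestor_cell (N : nat) k x : ancestor D N (cell k x) = cell (k - N%:Z) x.
Proof.
rewrite /ancestor; apply: xget_unique.
  by apply/descendantsP; exists x; [exact: in_cell | rewrite subrK].
move=> Q /= [[l DQ]]; have [z ->] := cell_ofP DQ => /cell_ofP[y E] kx.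
have kl : k = l + N%:Z by exact: cell_gen E.
rewrite kl addrK; apply/esym/cell_eq.
by apply: kx; exact: in_cell.
Qed.

Lemma measurable_cell k x : measurable (cell k x).
Proof.
have [a ->] := dyadic_cube D_dyadic (D_cell k x).
exact: measurable_cube.
Qed.

(** Boundedly many cubes of one generation fit into a box: rounding the corner
    of a cube to a multiple of the side length separates disjoint cubes. *)
Lemma cubes_in_box k (c : 'I_n -> R) (N : nat) (F : set (set (n.-tuple R))) :
  F `<=` D k ->
  (forall Q x i, F Q -> Q x -> c i <= tnth x i < c i + N.+1%:R * 2 ^ (- k)) ->
  finite_set F /\ (#|` fset_set F | <= N.+1 ^ n)%N.
Proof.
move=> FD Fbox; set l : R := 2 ^ (- k).
have l0 : 0 < l by exact: side_gt0.
have /choice [corner cornerP] :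
    forall Q, exists a, D k Q -> Q = cube a l.
  move=> Q; have [DQ|nDQ] := pselect (D k Q).
    by have [a aE] := dyadic_cube D_dyadic DQ; exists a.
  by exists [tuple 0 | i < n] => /nDQ.
pose code Q : {ffun 'I_n -> 'I_N.+1} :=
  [ffun i => inord (Num.truncn ((tnth (corner Q) i - c i) / l))].
have code_inj Q Q' : F Q -> F Q' -> code Q = code Q' -> Q = Q'.
  move=> FQ FQ' E.
  have trP P : F P -> forall i, let t := (tnth (corner P) i - c i) / l in
      ((code P i)%:R <= t < (code P i).+1%:R).
    move=> FP i /=; rewrite ffunE.
    have /(Fbox _ _ i FP) /andP[h1 h2] : P (corner P).
      by rewrite [X in X _](cornerP _ (FD _ FP)); exact: cube_corner.
    have t0 : 0 <= (tnth (corner P) i - c i) / l by rewrite divr_ge0 ?subr_ge0 // ltW.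
    rewrite inordK; first exact: truncn_itv.
    by rewrite truncn_lt_nat //; [rewrite ltr_pdivrMr// ltrBlDl]. 
  have [_ triv _] := dyadic_partition D_dyadic k.
  apply: triv; [exact: FD|exact: FD|].
  rewrite (cornerP _ (FD _ FQ)) (cornerP _ (FD _ FQ')).
  apply: cube_meet => i.
  have := trP _ FQ i; have := trP _ FQ' i; rewrite E /= => /andP[a1 a2] /andP[b1 b2].
  have : `|(tnth (corner Q) i - c i) / l - (tnth (corner Q') i - c i) / l| < 1.
    by rewrite ltr_norml; move: a2 b2; rewrite -natr1; lra.
  rewrite -mulrBl normrM (gtr0_norm (_ : 0 < l^-1)) ?invr_gt0//.
  rewrite ltr_pdivrMr// mul1r.
  by congr (`|_| < _); ring.
pose g (phi : {ffun 'I_n -> 'I_N.+1}) := xget set0 [set Q | F Q /\ code Q = phi].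
have gK Q : F Q -> g (code Q) = Q.
  move=> FQ; apply: xget_unique => //= Q' [FQ' E].
  by apply: code_inj.
have Fsub : F `<=` [set` [fset g phi | phi in {ffun 'I_n -> 'I_N.+1}]%fset].
  move=> Q FQ /=; apply/imfsetP; exists (code Q) => //.
  by rewrite gK.
have finF : finite_set F.
  by apply: sub_finite_set Fsub _; exact: finite_fset.
split => //; apply: (@leq_trans #|` [fset g phi | phi in {ffun 'I_n -> 'I_N.+1}]%fset |).
  by apply: fsubset_leq_card; apply/fsubsetP => Q; rewrite in_fset_set// inE => /Fsub.
apply: (leq_trans (leq_imfset_card _ _ _)).
by rewrite /= -cardE card_ffun !card_ord.
Qed.

Lemma descendants_finite_card (r : nat) k x :
  finite_set (descendants D r (cell k x)) /\
  (#|` fset_set (descendants D r (cell k x)) | <= (2 ^ r) ^ n)%N.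
Proof.
have [a aE] := dyadic_cube D_dyadic (D_cell k x).
have [] := @cubes_in_box (k + r%:Z) (tnth a) (2 ^ r).-1 (descendants D r (cell k x)).
- by move=> P /descendantsP[y _ ->]; exact: D_cell.
- move=> P y i [_ PQ] /PQ; rewrite aE => /(_ i).
  rewrite prednK ?expn_gt0// natrX exprnP -expfzDr ?pnatr_eq0//.
  by rewrite opprD addrCA subrr addr0.
by rewrite prednK ?expn_gt0.
Qed.

Lemma finite_descendants (r : nat) k x :
  finite_set (descendants D r (cell k x)).
Proof. by case: (descendants_finite_card r k x). Qed.

(** Every cube contains a point with rational coordinates, so that preimages
    under f are countable unions of cubes. *)
Lemma measurable_const_on_cells d (T : measurableType d) k (f : n.-tuple R -> T) :
  (forall x y, cell k x y -> f x = f y) -> measurable_fun [set: n.-tuple R] f.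
Proof.
move=> fk _ A _; rewrite setTI.
pose pt (q : n.-tuple rat) : n.-tuple R := [tuple ratr (tnth q i) | i < n].
pose F (i : nat) := if @choice.unpickle (n.-tuple rat) i is Some q then
  (if `[< (f @^-1` A) (pt q) >] then cell k (pt q) else set0) else set0.
have -> : f @^-1` A = \bigcup_i F i.
  apply/seteqP; split=> x /=.
    have [a aE] := dyadic_cube D_dyadic (D_cell k x).
    have /choice [q qP] : forall i, exists q : rat,
        ratr q \in `]tnth a i, (tnth a i + 2 ^ (- k))[.
      by move=> i; apply: rat_in_itvoo; rewrite ltrDl side_gt0.
    have xq : cell k x (pt [tuple q i | i < n]).
      rewrite aE => i; rewrite !tnth_mktuple.
      by have := qP i; rewrite in_itv /= => /andP[/ltW -> ->].
    move=> Afx; exists (choice.pickle [tuple q i | i < n]) => //.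
    rewrite /F choice.pickleK asboolT /=; last by rewrite -(fk _ _ xq).
    by rewrite (cell_eq xq); exact: in_cell.
  move=> [i _]; rewrite /F; case: choice.unpickle => // q.
  by case: asboolP => // Aq /fk <-.
apply: bigcup_measurable => i _; rewrite /F; case: choice.unpickle => // q.
by case: asboolP => // _; exact: measurable_cell.
Qed.

End cells.

(** * Integrals over cubes and the values of Haar functions *)

Section cell_integrals.
Context {R : realType} {n : nat} (n_gt0 : (0 < n)%N).
Context (D : int -> set (set (n.-tuple R))) (D_dyadic : dyadic_system D).
Context (mu : {measure set (n.-tuple R) -> \bar R}) (mu_D : dyadic_measure D mu).
Implicit Types (x y : n.-tuple R) (k l : int) (P Q : set (n.-tuple R)).

Local Notation cell := (cell D).

Definition mass Q : R := fine (mu Q).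

Lemma mu_cell k x : mu (cell k x) = (mass (cell k x))%:E.
Proof.
rewrite fineK // ge0_fin_numE //.
by apply: (dyadic_measure_fin mu_D); exact: dyadic_cell.
Qed.

Lemma mass_gt0 k x : 0 < mass (cell k x).
Proof.
by rewrite -lte_fin -mu_cell; apply: (dyadic_measure_gt0 mu_D); exact: dyadic_cell.
Qed.

Lemma mass_ge0 Q : 0 <= mass Q. Proof. exact: fine_ge0. Qed.

Lemma mass_le k l x : k <= l -> mass (cell l x) <= mass (cell k x).
Proof.
move=> kl; rewrite -lee_fin -!mu_cell; apply: le_measure.
- by rewrite inE; exact: measurable_cell.
- by rewrite inE; exact: measurable_cell.
- exact: cell_sub.
Qed.

Definition desc (r : nat) Q : {fset (set (n.-tuple R))} :=
  fset_set (descendants D r Q).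

Lemma in_desc (r : nat) k x P :
  reflect (exists2 y, cell k x y & P = cell (k + r%:Z) y) (P \in desc r (cell k x)).
Proof.
rewrite /desc in_fset_set; last exact: finite_descendants.
apply: (iffP idP); rewrite inE.
  by move/(descendantsP n_gt0 D_dyadic).
by move=> ?; apply/(descendantsP n_gt0 D_dyadic).
Qed.

Lemma cell_desc (r : nat) k x y : cell k x y ->
  cell (k + r%:Z) y \in desc r (cell k x).
Proof. by move=> xy; apply/in_desc; exists y. Qed.

Lemma desc_sub (r : nat) k x P : P \in desc r (cell k x) -> P `<=` cell k x.
Proof.
move=> /in_desc[y xy ->]; rewrite -(cell_eq D_dyadic xy).
by apply: cell_sub => //; lia.
Qed.

Lemma desc_cover (r : nat) k x :
  \big[setU/set0]_(P <- desc r (cell k x)) P = cell k x.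
Proof.
rewrite -bigcup_seq; apply/seteqP; split => [y [P /= Pd Py]|y xy].
  exact: desc_sub Pd _ Py.
by exists (cell (k + r%:Z) y); [exact: cell_desc | exact: in_cell].
Qed.

Lemma desc_triv (r : nat) k x : trivIset [set` desc r (cell k x)] id.
Proof.
move=> P Q /= /in_desc[y xy ->] /in_desc[z xz ->] [w [yw zw]].
by rewrite -(cell_eq D_dyadic yw) -(cell_eq D_dyadic zw).
Qed.

Lemma integrable_cellS k l x y f : cell k x y -> k <= l ->
  mu.-integrable (cell k x) f -> mu.-integrable (cell l y) f.
Proof.
move=> xy kl; apply: integrableS; [exact: measurable_cell..|].
by rewrite -(cell_eq D_dyadic xy); exact: cell_sub.
Qed.

Lemma Rintegral_desc (r : nat) k x (f : n.-tuple R -> R) :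
  mu.-integrable (cell k x) (EFin \o f) ->
  \int[mu]_(y in cell k x) f y =
  \sum_(P <- desc r (cell k x)) \int[mu]_(y in P) f y.
Proof.
move=> fi; pose F P := if `[< measurable P >] then P else set0.
have FE P : P \in desc r (cell k x) -> F P = P.
  move=> /in_desc[y _ ->]; rewrite /F asboolT //; exact: measurable_cell.
have cov : cell k x = \big[setU/set0]_(P <- desc r (cell k x)) F P.
  by rewrite -{1}(@desc_cover r); apply: eq_big_seq => P /FE ->.
rewrite /Rintegral {1}cov integral_bigsetU_EFin //=; last 3 first.
- by move=> P; rewrite /F; case: asboolP.
- by move=> P Q /= Pd Qd; rewrite !FE //; exact: (@desc_triv r k x P Q Pd Qd).
- by rewrite -cov; case/integrableP : fi.
rewrite big_seq [RHS]big_seq -sum_fine.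
  by apply: eq_bigr => P /FE ->.
move=> P Pd; rewrite FE //; move: Pd => /in_desc[y xy ->].
apply: integrable_fin_num; first exact: measurable_cell.
by apply: integrable_cellS fi => //; lia.
Qed.

Lemma integrable_cst_cell k x (c : R) : mu.-integrable (cell k x) (EFin \o cst c).
Proof.
apply: measurable_bounded_integrable => //; first exact: measurable_cell.
  by apply: (dyadic_measure_fin mu_D); exact: dyadic_cell.
exists `|c|; split; first exact: num_real.
by move=> M cM y _ /=; exact: ltW.
Qed.

Lemma mass_desc (r : nat) k x :
  mass (cell k x) = \sum_(P <- desc r (cell k x)) mass P.
Proof.
have E Q : measurable Q -> mass Q = \int[mu]_(y in Q) cst 1 y.
  by move=> mQ; rewrite Rintegral_cst// mul1r.
rewrite E; last exact: measurable_cell.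
rewrite (Rintegral_desc r); last exact: integrable_cst_cell.
apply: eq_big_seq => P /in_desc[y _ ->].
by rewrite -E //; exact: measurable_cell.
Qed.

Lemma mass_desc_gt0 (r : nat) k x P : P \in desc r (cell k x) -> 0 < mass P.
Proof. by move=> /in_desc[y _ ->]; exact: mass_gt0. Qed.

Lemma size_desc (r : nat) k x : (size (desc r (cell k x)) <= (2 ^ r) ^ n)%N.
Proof. by have [_] := descendants_finite_card n_gt0 D_dyadic r k x. Qed.

Context (h : haar_family R n) (h_haar : haar_system D mu h).

Definition point_of P : n.-tuple R := xget [tuple 0 | i < n] P.

Lemma point_ofP P y : P y -> P (point_of P).
Proof. by move=> Py; exact: (@xgetI _ _ P y). Qed.

Definition hval Q j P : R := h Q j (point_of P).

Lemma haar_cell k x y j : cell k x y ->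
  h (cell k x) j y = hval (cell k x) j (cell (k + 1%:Z) y).
Proof.
move=> xy; apply: (haar_const h_haar (P := cell (k + 1%:Z) y)).
- exact: dyadic_cell.
- by apply/descendantsP => //; exists y.
- exact: in_cell.
- by apply: (@point_ofP _ y); exact: in_cell.
Qed.

Lemma haar_out k x y j : ~ cell k x y -> h (cell k x) j y = 0.
Proof. by apply: (haar_support h_haar); exact: dyadic_cell. Qed.

Lemma haar_eq k x y z j : cell (k + 1%:Z) y z -> h (cell k x) j y = h (cell k x) j z.
Proof.
move=> yz; have E : cell k z = cell k y.
  by apply: cell_eq_le yz => //; lia.
have [xy|nxy] := pselect (cell k x y).
  rewrite !haar_cell // ?(cell_eq _ yz) //.
  by rewrite -(cell_eq _ xy) // -E; exact: in_cell.
rewrite !haar_out // => xz; apply: nxy.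
by rewrite -(cell_eq _ xz) // E; exact: in_cell.
Qed.

Lemma measurable_haar k x j : measurable_fun [set: n.-tuple R] (h (cell k x) j).
Proof.
apply: (measurable_const_on_cells D_dyadic (k := k + 1%:Z)) => y z.
exact: haar_eq.
Qed.

Lemma haar_le k x j y :
  `|h (cell k x) j y| <= \sum_(P <- desc 1 (cell k x)) `|hval (cell k x) j P|.
Proof.
have [xy|nxy] := pselect (cell k x y); last first.
  by rewrite haar_out // normr0 sumr_ge0.
rewrite haar_cell // (big_rem _ (@cell_desc 1 _ _ _ xy)) /= lerDl.
by rewrite sumr_ge0.
Qed.

Lemma inner_haar k x j (f : n.-tuple R -> R) :
  mu.-integrable (cell k x) (EFin \o f) ->
  inner mu f (h (cell k x) j) =
  \sum_(P <- desc 1 (cell k x)) hval (cell k x) j P * \int[mu]_(y in P) f y.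
Proof.
move=> fi; rewrite /inner.
transitivity (\int[mu]_(y in cell k x) (f y * h (cell k x) j y)).
  rewrite [RHS]Rintegral_mkcond; apply: eq_Rintegral => y _.
  rewrite patchE; case: ifPn => // /negP; rewrite inE => nxy.
  by rewrite haar_out // mulr0.
rewrite (Rintegral_desc 1); last first.
  have := @integrableMl _ _ _ mu (cell k x) (measurable_cell D_dyadic k x)
      _ (h (cell k x) j) fi.
  apply.
    by apply: measurable_funS (measurable_haar k x j).
  exists (\sum_(P <- desc 1 (cell k x)) `|hval (cell k x) j P|).
  split; first exact: num_real.
  by move=> M hM y _ /=; apply: (le_trans (haar_le _ _ _ _)); exact: ltW.
apply: eq_big_seq => P /in_desc[y xy ->].
rewrite mulrC -RintegralZr; last 2 first.
- exact: measurable_cell.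
- by apply: integrable_cellS fi => //; lia.
apply: eq_Rintegral => z; rewrite inE => yz.
by rewrite haar_cell ?(cell_eq _ yz)//; apply: (@desc_sub 1) yz; exact: cell_desc.
Qed.

Lemma Rintegral_haar k x j P : P \in desc 1 (cell k x) ->
  \int[mu]_(y in P) h (cell k x) j y = hval (cell k x) j P * mass P.
Proof.
move=> /in_desc[y xy ->]; rewrite -Rintegral_cst; last exact: measurable_cell.
apply: eq_Rintegral => z; rewrite inE => yz.
by rewrite haar_cell ?(cell_eq _ yz)//; apply: (@desc_sub 1) yz; exact: cell_desc.
Qed.

Lemma integrable_haar k x j l y : mu.-integrable (cell l y) (EFin \o h (cell k x) j).
Proof.
apply: measurable_bounded_integrable; first exact: measurable_cell.
- by apply: (dyadic_measure_fin mu_D); exact: dyadic_cell.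
- by apply: measurable_funS (measurable_haar k x j).
exists (\sum_(P <- desc 1 (cell k x)) `|hval (cell k x) j P|).
split; first exact: num_real.
by move=> M hM z _ /=; apply: (le_trans (haar_le _ _ _ _)); exact: ltW.
Qed.

Lemma hval_orthonormal k x j j' :
  \sum_(P <- desc 1 (cell k x))
    hval (cell k x) j P * hval (cell k x) j' P * mass P = (j == j')%:R.
Proof.
have Q : dyadic D (cell k x) by exact: dyadic_cell.
have := haar_orthonormal h_haar j j' Q Q.
rewrite eqxx /= => <-; rewrite inner_haar; last exact: integrable_haar.
by apply: eq_big_seq => P Pd; rewrite Rintegral_haar // mulrCA mulrA.
Qed.

Lemma hval_cancel k x j :
  \sum_(P <- desc 1 (cell k x)) hval (cell k x) j P * mass P = 0.
Proof.
have Q : dyadic D (cell k x) by exact: dyadic_cell.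
have := haar_cancel h_haar j Q.
rewrite (_ : \int[mu]_y _ = inner mu (cst 1) (h (cell k x) j)); last first.
  by apply: eq_Rintegral => y _; rewrite mul1r.
rewrite inner_haar; last exact: integrable_cst_cell.
move=> E; rewrite -[RHS]E.
apply: eq_big_seq => P /in_desc[y xy ->].
by rewrite Rintegral_cst ?mul1r //; exact: measurable_cell.
Qed.

(** The 2^n - 1 Haar functions of Q and the constant function are 2^n
    orthonormal vectors in the space of functions constant on the at most 2^n
    children of Q.  They form a square matrix U with U U^T = 1, so that
    U^T U = 1, the diagonal of which is the formula below. *)
Lemma hval_parseval k x P : P \in desc 1 (cell k x) ->
  \sum_j hval (cell k x) j P ^+ 2 = (mass P)^-1 - (mass (cell k x))^-1.
Proof.
move=> Pd; set Q := cell k x; set N := (2 ^ n).-1.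
have N1 : (1 + N = 2 ^ n)%N by rewrite add1n prednK // expn_gt0.
pose s : seq (set (n.-tuple R)) := desc 1 Q.
have sN : (size s <= 1 + N)%N by rewrite N1; exact: (size_desc 1 k x).
have w0 P' : P' \in s -> 0 < mass P' by exact: (@mass_desc_gt0 1 k x).
have M0 : 0 < mass Q by exact: mass_gt0.
pose w i := Num.sqrt (mass (nth set0 s i)).
pose U : 'M[R]_(1 + N) := \matrix_(a, i) (if (i < size s)%N then
   (if fintype.split a is inr j then hval Q j (nth set0 s i) else (Num.sqrt (mass Q))^-1) * w i
   else 0).
have sumU (F : set (n.-tuple R) -> R) :
    \sum_(i < 1 + N) (if (i < size s)%N then F (nth set0 s i) else 0) =
    \sum_(P' <- s) F P'.
  rewrite (big_nth set0) big_mkord -big_mkcond /=.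
  by rewrite -(big_ord_widen _ (fun i => F (nth set0 s i)) sN).
have w2 i : (i < size s)%N -> w i * w i = mass (nth set0 s i).
  by move=> iS; rewrite -expr2 sqr_sqrtr // ltW // w0 // mem_nth.
have UU : U *m U^T = 1%:M.
  apply/matrixP => a b; rewrite !mxE.
  pose v (a : 'I_(1 + N)) P' :=
    if fintype.split a is inr j then hval Q j P' else (Num.sqrt (mass Q))^-1.
  transitivity (\sum_(P' <- s) v a P' * v b P' * mass P').
    rewrite -sumU; apply: eq_bigr => i _; rewrite !mxE.
    by case: ifPn => iS; rewrite ?mul0r // -w2 // /v mulrACA.
  rewrite -[a in RHS]splitK -[b in RHS]splitK /v.
  case: (fintype.split a) => [a0|ja]; case: (fintype.split b) => [b0|jb].
  - rewrite !ord1 eqxx -mulr_sumr -(mass_desc 1) -expr2 exprVn.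
    by rewrite sqr_sqrtr ?(ltW M0)// mulVf // gt_eqF.
  - under eq_bigr do rewrite -mulrA.
    by rewrite -mulr_sumr hval_cancel mulr0 /= eq_lrshift.
  - under eq_bigr do rewrite [X in X * _]mulrC -mulrA.
    by rewrite -mulr_sumr hval_cancel mulr0 /= eq_rlshift.
  - by rewrite hval_orthonormal /= eq_rshift.
have UTU := mulmx1C UU.
have Ps : P \in s by [].
have iP : (index P s < size s)%N by rewrite index_mem.
pose i := Ordinal (leq_trans iP sN).
have := congr1 (fun A : 'M[R]_(1 + N) => A i i) UTU.
rewrite !mxE eqxx big_split_ord /= big_ord1 !mxE /= iP.
under eq_bigr do rewrite !mxE /= iP.
case: splitP => [a0 _|j /=]; last by [].
rewrite nth_index // => E.
have P0 := w0 _ Ps.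
have E2 : (mass Q)^-1 * mass P + \sum_j hval Q j P ^+ 2 * mass P = 1.
  rewrite -[RHS]E; congr (_ + _).
    rewrite mulrACA -!expr2 exprVn sqr_sqrtr ?(ltW M0)//.
    by rewrite /w nth_index // sqr_sqrtr // ltW.
  apply: eq_bigr => j _; case: splitP => [b0 /= E0|j' /=].
    by have := ltn_ord b0; rewrite -E0.
  move=> /eqP; rewrite eqn_add2l => /eqP /val_inj <-.
  by rewrite mulrACA -!expr2 /w nth_index // sqr_sqrtr // ltW.
rewrite -mulr_suml -mulrDl in E2.
rewrite -[X in X - _]mul1r -E2 mulrK ?unitfE ?gt_eqF//.
by ring.
Qed.

End cell_integrals.

(** * Increments of a power along a chain of cubes *)

Section power_increments.
Context {R : realType} (alpha : R) (alpha_gt0 : 0 < alpha).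
Implicit Types (m M d L : R).

Definition tele_const : R := 2 * (1 + alpha) / alpha.

Lemma tele_const_gt0 : 0 < tele_const.
Proof. by rewrite /tele_const divr_gt0// mulr_gt0// addr_gt0. Qed.

(** Both 1 + u <= exp u and t <= exp (t - 1) are used, with u = alpha (1 - t);
    this covers alpha < 1 and alpha >= 1 at once. *)
Lemma powR_le_inv t : 0 < t -> t `^ alpha * (1 + alpha * (1 - t)) <= 1.
Proof.
move=> t0; have ta0 : 0 <= t `^ alpha by exact: powR_ge0.
have le1 : 1 + alpha * (1 - t) <= expR (alpha * (1 - t)) by exact: expR_ge1Dx.
have le2 : t `^ alpha <= expR (alpha * (t - 1)).
  rewrite mulrC expRM; apply: ge0_ler_powR; rewrite ?nnegrE ?(ltW alpha_gt0) ?expR_ge0 ?(ltW t0)//.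
  by have := expR_ge1Dx (t - 1); rewrite addrC subrK.
apply: (le_trans (ler_wpM2l ta0 le1)).
apply: (le_trans (ler_wpM2r (expR_ge0 _) le2)).
by rewrite -expRD -mulrDr addrC addrA subrK subrr mulr0 expR0.
Qed.

(** Here m is the mass of a child of a cube of mass M.  If m <= M / 2 the first
    bound suffices, since m^alpha is then at most a fixed fraction of M^alpha;
    if m > M / 2 the second one does, since (M - m) M^(alpha - 1) is comparable
    to M^alpha - m^alpha. *)
Lemma jump_telescopes m M d : 0 < m -> m <= M ->
  `|d| <= m `^ alpha -> m * `|d| <= (M - m) * M `^ alpha ->
  `|d| <= tele_const * (M `^ alpha - m `^ alpha).
Proof.
move=> m0 mM d1 d2; have M0 : 0 < M by exact: lt_le_trans mM.
pose t := m / M; have t0 : 0 < t by rewrite divr_gt0.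
have mE : m = t * M by rewrite /t divfK ?gt_eqF.
have t1 : t <= 1 by rewrite /t ler_pdivrMr// mul1r.
have A0 : 0 < M `^ alpha by exact: powR_gt0.
have b0 : 0 < t `^ alpha by exact: powR_gt0.
have key := powR_le_inv t0.
have maE : m `^ alpha = t `^ alpha * M `^ alpha.
  by rewrite {1}mE powRM// ltW.
rewrite maE in d1 *.
set b := t `^ alpha in b0 key d1 *; set A := M `^ alpha in A0 d1 d2 *.
have -> : tele_const * (A - b * A) = tele_const * (1 - b) * A by ring.
have u0 : 0 <= alpha * (1 - t) by rewrite mulr_ge0 ?(ltW alpha_gt0)// subr_ge0.
have ua : alpha * (1 - t) <= alpha by rewrite ler_piMr ?(ltW alpha_gt0)//; lra.
have bu0 : 0 <= b * (alpha * (1 - t)) by rewrite mulr_ge0 ?(ltW b0).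
have b1 : 0 <= 1 - b by move: key; lra.
have ab1 : 0 <= alpha * (1 - b) by rewrite mulr_ge0 ?(ltW alpha_gt0).
have [tl|tg] := lerP t 2^-1.
  apply: (le_trans d1); rewrite ler_pM2r// /tele_const mulrAC ler_pdivlMr//.
  have bt : b * alpha * 2^-1 <= b * alpha * (1 - t).
    by apply: ler_wpM2l; [rewrite mulr_ge0 ?(ltW b0) ?(ltW alpha_gt0) | lra].
  by lra.
have d3 : `|d| <= 2 * (1 - t) * A.
  have : t * `|d| <= (1 - t) * A.
    by rewrite -(ler_pM2l M0); move: d2; rewrite mE; lra.
  have : (t - 2^-1) * `|d| >= 0 by rewrite mulr_ge0// subr_ge0 ltW.
  by lra.
apply: (le_trans d3); rewrite ler_pM2r// /tele_const mulrAC ler_pdivlMr//.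
have : alpha * (1 - t) <= (1 + alpha * (1 - t)) * (1 - b) by move: key; lra.
have : (alpha * (1 - t)) * (1 - b) <= alpha * (1 - b) by apply: ler_wpM2r.
by lra.
Qed.

(** The quantity m (1 - m / M) = m (M - m) / M is half the harmonic mean of m
    and M - m, hence at least half of the smaller one of them. *)
Lemma jump_harmonic m M d : 0 < m -> m <= M ->
  `|d| <= m `^ alpha -> m * `|d| <= (M - m) * (M - m) `^ alpha ->
  `|d| <= (2 * (m * (1 - m / M))) `^ alpha.
Proof.
move=> m0 mM d1 d2; have M0 : 0 < M by exact: lt_le_trans mM.
have mono x y : 0 <= x -> x <= y -> x `^ alpha <= y `^ alpha.
  by move=> x0 xy; apply: ge0_ler_powR; rewrite ?nnegrE ?(ltW alpha_gt0)// (le_trans x0).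
pose t := m / M; have t0 : 0 < t by rewrite divr_gt0.
have mE : m = t * M by rewrite /t divfK ?gt_eqF.
have t1 : t <= 1 by rewrite /t ler_pdivrMr// mul1r.
rewrite -/t; have [tl|tg] := lerP t 2^-1.
  by apply: (le_trans d1); apply: mono; [exact: ltW | nra].
have : m * `|d| <= m * (M - m) `^ alpha.
  apply: (le_trans d2); apply: ler_wpM2r; first exact: powR_ge0.
  by rewrite mE; nra.
rewrite ler_pM2l// => /le_trans; apply; apply: mono; first by rewrite subr_ge0.
by rewrite mE; nra.
Qed.

Section mean_zero.
Context (I : eqType) (s : seq I) (s_uniq : uniq s) (w d : I -> R).
Hypothesis w_gt0 : forall i, i \in s -> 0 < w i.
Hypothesis mean0 : \sum_(i <- s) w i * d i = 0.
Context (L : R) (L_ge0 : 0 <= L).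
Hypothesis d_le : forall i, i \in s -> `|d i| <= L * w i `^ alpha.

Let W := \sum_(i <- s) w i.

Let wW i : i \in s -> w i <= W.
Proof.
move=> si; rewrite /W (bigD1_seq i)//= lerDl big_seq_cond sumr_ge0// => j /andP[sj _].
exact: ltW (w_gt0 sj).
Qed.

(* Mean zero turns the jump on i into an average of the other jumps. *)
Let complement i : i \in s ->
  w i * `|d i| <= L * ((W - w i) * (W - w i) `^ alpha).
Proof.
move=> si; have wi0 := w_gt0 si.
have -> : W - w i = \sum_(j <- s | j != i) w j.
  by rewrite /W (bigD1_seq i)//= addrC addrK.
have -> : w i * `|d i| = `|\sum_(j <- s | j != i) w j * d j|.
  move: mean0; rewrite (bigD1_seq i)//= => /eqP.
  rewrite addrC addr_eq0 => /eqP ->.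
  by rewrite normrN normrM gtr0_norm.
apply: (le_trans (ler_norm_sum _ _ _)).
rewrite mulrCA mulr_suml big_seq_cond [leRHS]big_seq_cond.
apply: ler_sum => j /andP[sj ji].
rewrite normrM (gtr0_norm (w_gt0 sj)) ler_pM2l ?w_gt0//.
apply: (le_trans (d_le sj)); apply: ler_wpM2l => //.
have le1 : w j <= \sum_(j <- s | j != i) w j.
  rewrite -big_filter (bigD1_seq j) ?filter_uniq ?mem_filter ?ji//= lerDl.
  rewrite big_seq_cond sumr_ge0// => l /andP[].
  by rewrite mem_filter => /andP[_ sl] _; exact: ltW (w_gt0 sl).
apply: ge0_ler_powR; rewrite ?nnegrE ?(ltW alpha_gt0) ?(ltW (w_gt0 sj))//.
by apply: le_trans le1; exact: ltW (w_gt0 sj).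
Qed.

Let normalized i : i \in s -> 0 < L -> `|d i / L| <= w i `^ alpha /\
  w i * `|d i / L| <= (W - w i) * (W - w i) `^ alpha.
Proof.
move=> si L0; rewrite normrM (gtr0_norm (_ : 0 < L^-1)) ?invr_gt0//.
rewrite mulrA !ler_pdivrMr//; split; first by rewrite [leRHS]mulrC; exact: d_le.
by rewrite [leRHS]mulrC; exact: complement.
Qed.

Lemma mean_zero_telescopes i : i \in s ->
  `|d i| <= L * (tele_const * (W `^ alpha - w i `^ alpha)).
Proof.
move=> si; move: (L_ge0); rewrite le_eqVlt => /orP[/eqP L0|L0].
  by apply: (le_trans (d_le si)); rewrite -L0 !mul0r.
have [n1 n2] := normalized si L0.
have wi0 := w_gt0 si.
have : `|d i / L| <= tele_const * (W `^ alpha - w i `^ alpha).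
  apply: jump_telescopes => //; first exact: wW.
  apply: (le_trans n2); apply: ler_wpM2l; first by rewrite subr_ge0 wW.
  apply: ge0_ler_powR; rewrite ?nnegrE ?(ltW alpha_gt0)// ?subr_ge0 ?wW//.
    by apply: le_trans (wW si); exact: ltW.
  by rewrite gerBl ltW.
by rewrite normrM (gtr0_norm (_ : 0 < L^-1)) ?invr_gt0// ler_pdivrMr// mulrC.
Qed.

Lemma mean_zero_harmonic i : i \in s ->
  `|d i| <= L * (2 * (w i * (1 - w i / W))) `^ alpha.
Proof.
move=> si; move: (L_ge0); rewrite le_eqVlt => /orP[/eqP L0|L0].
  by apply: (le_trans (d_le si)); rewrite -L0 !mul0r.
have [n1 n2] := normalized si L0.
have wi0 := w_gt0 si.
have : `|d i / L| <= (2 * (w i * (1 - w i / W))) `^ alpha.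
  by apply: jump_harmonic => //; exact: wW.
by rewrite normrM (gtr0_norm (_ : 0 < L^-1)) ?invr_gt0// ler_pdivrMr// mulrC.
Qed.

End mean_zero.
End power_increments.

(** * Balanced measures and Haar coefficients *)

Section balanced_masses.
Context {R : realType} {n : nat} (n_gt0 : (0 < n)%N).
Context (D : int -> set (set (n.-tuple R))) (D_dyadic : dyadic_system D).
Context (mu : {measure set (n.-tuple R) -> \bar R}) (mu_D : dyadic_measure D mu).
Context (h : haar_family R n) (h_haar : haar_system D mu h).
Implicit Types (x y : n.-tuple R) (k l : int) (P Q : set (n.-tuple R)).

Local Notation cell := (cell D).
Local Notation desc := (desc D).
Local Notation mass := (mass mu).
Local Notation hval := (hval h).

Definition haar_L1 Q j : R := \sum_(P <- desc 1 Q) `|hval Q j P| * mass P.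
(** The sum of the absolute values replaces their maximum, to which it is
    comparable because a cube has at most 2^n children. *)
Definition haar_sup Q j : R := \sum_(P <- desc 1 Q) `|hval Q j P|.

Lemma haar_L1_ge0 Q j : 0 <= haar_L1 Q j.
Proof. by apply: sumr_ge0 => P _; rewrite mulr_ge0// mass_ge0. Qed.

Lemma haar_sup_ge0 Q j : 0 <= haar_sup Q j.
Proof. by apply: sumr_ge0. Qed.

Lemma haar_sup_ge Q j P : P \in desc 1 Q -> `|hval Q j P| <= haar_sup Q j.
Proof. by move=> PQ; rewrite /haar_sup (big_rem _ PQ) /= lerDl sumr_ge0. Qed.

Lemma haar_L1_ge Q j P : P \in desc 1 Q -> `|hval Q j P| * mass P <= haar_L1 Q j.
Proof.
move=> PQ; rewrite /haar_L1 (big_rem _ PQ) /= lerDl sumr_ge0// => P' _.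
by rewrite mulr_ge0// mass_ge0.
Qed.

(** This is 1 = |h|_2^2 <= |h|_1 |h|_oo.  It allows bounds on products of an L^1
    norm and a supremum norm to be composed along a chain of cubes. *)
Lemma haar_L1_sup_ge1 k x j : 1 <= haar_L1 (cell k x) j * haar_sup (cell k x) j.
Proof.
have := hval_orthonormal n_gt0 D_dyadic mu_D h_haar k x j j.
rewrite eqxx mulr1n => <-; rewrite /haar_L1 mulr_suml.
rewrite big_seq [leRHS]big_seq; apply: ler_sum => P PQ.
rewrite (le_trans (ler_norm _))// normrM normrM (ger0_norm (mass_ge0 _ _)).
rewrite -mulrA mulrC; apply: ler_wpM2l; last exact: haar_sup_ge.
by rewrite mulr_ge0// mass_ge0.
Qed.

Lemma haar_L1_le k x j :
  ((haar_L1 (cell k x) j)%:E <= 'N[mu]_1[EFin \o h (cell k x) j])%E.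
Proof.
rewrite Lnorm1.
have ih := integrable_haar n_gt0 D_dyadic mu_D h_haar k x j k x.
have ih' : mu.-integrable (cell k x) (EFin \o (fun y => `|h (cell k x) j y|)).
  exact: integrable_norm ih.
have -> : haar_L1 (cell k x) j = \int[mu]_(y in cell k x) `|h (cell k x) j y|.
  rewrite (Rintegral_desc n_gt0 D_dyadic 1 ih'); apply: eq_big_seq => P.
  move=> /(in_desc n_gt0 D_dyadic)[y xy ->].
  rewrite -Rintegral_cst; last exact: measurable_cell.
  apply: eq_Rintegral => z; rewrite inE => yz.
  rewrite (haar_cell n_gt0 D_dyadic h_haar) ?(cell_eq _ yz)//.
  by rewrite -(cell_eq D_dyadic xy); apply: cell_sub yz => //; lia.
rewrite /Rintegral fineK; last first.
  by apply: integrable_fin_num ih'; exact: measurable_cell.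
apply: ge0_subset_integral => //; first exact: measurable_cell.
apply/measurable_EFinP; apply: (measurableT_comp (@normr_measurable R setT)).
exact: (measurable_haar n_gt0 D_dyadic h_haar).
Qed.

Lemma hval_le_Linfty k x j P : P \in desc 1 (cell k x) ->
  (`|hval (cell k x) j P|%:E <= 'N[mu]_+oo[EFin \o h (cell k x) j])%E.
Proof.
move=> /(in_desc n_gt0 D_dyadic)[y xy ->].
set c := cell (k + 1%:Z) y.
have mc : measurable c by exact: measurable_cell.
have c0 : (0 < mu c)%E by rewrite (mu_cell D_dyadic mu_D) lte_fin mass_gt0.
rewrite unlock ifT; last by apply: (lt_le_trans c0); apply: le_measure; rewrite ?inE.
rewrite leNgt; apply/negP => lt.
have [N [mN N0 sub]] := ess_sup_ge mu (abse \o (EFin \o h (cell k x) j)).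
suff : (mu c <= mu N)%E by rewrite N0 leNgt c0.
apply: le_measure; rewrite ?inE// => z cz; apply: sub => /=.
rewrite (haar_cell n_gt0 D_dyadic h_haar) ?(cell_eq _ cz)//.
  by rewrite -/c leNgt lt.
by rewrite -(cell_eq D_dyadic xy); apply: cell_sub cz => //; lia.
Qed.

Context (mu_balanced : balanced D mu h).

Lemma balanced_children : exists B : R, 1 <= B /\
  forall k x P j j', P \in desc 1 (cell k x) ->
    haar_L1 (cell k x) j * haar_sup P j' <= B /\
    haar_L1 P j' * haar_sup (cell k x) j <= B.
Proof.
move: mu_balanced; rewrite /balanced; set S := (X in ereal_sup X) => Sfin.
have [B0 B0P] : exists B : R, forall z, S z -> (z <= B%:E)%E.
  move: Sfin; case E : (ereal_sup S) => [b| |] //= _.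
    by exists b => z Sz; rewrite -E; exact: ereal_sup_ubound.
  exists 0 => z Sz; apply: (@le_trans _ _ (ereal_sup S)).
    exact: ereal_sup_ubound.
  by rewrite E leNye.
have Bpair k x y j j' : cell k x y ->
   let P := cell (k + 1%:Z) y in
   (forall P', P' \in desc 1 P -> haar_L1 (cell k x) j * `|hval P j' P'| <= B0) /\
   (forall P', P' \in desc 1 (cell k x) -> `|hval (cell k x) j P'| * haar_L1 P j' <= B0).
  move=> xy P.
  have Sz : S ('N[mu]_1[EFin \o h (cell k x) j] * 'N[mu]_+oo[EFin \o h P j'] +
             'N[mu]_+oo[EFin \o h (cell k x) j] * 'N[mu]_1[EFin \o h P j'])%E.
    exists (cell k x), P, j, j'; split => //; first exact: dyadic_cell.
    by apply/descendantsP => //; exists y.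
  have {}Sz := B0P _ Sz.
  split=> P' P'd; rewrite -lee_fin EFinM; apply: le_trans Sz.
    apply: (le_trans _ (leeDl _ _)).
      apply: lee_pmul; rewrite ?lee_fin ?haar_L1_ge0//.
        exact: haar_L1_le.
      exact: hval_le_Linfty.
    by rewrite mule_ge0 ?Lnorm_ge0.
  apply: (le_trans _ (leeDr _ _)).
    apply: lee_pmul; rewrite ?lee_fin ?haar_L1_ge0//.
      exact: hval_le_Linfty.
    exact: haar_L1_le.
  by rewrite mule_ge0 ?Lnorm_ge0.
have B'0 : 0 <= Num.max B0 0 by rewrite le_max lexx orbT.
exists (1 + (2 ^ n)%:R * Num.max B0 0); split; first by rewrite lerDl mulr_ge0.
move=> k x P j j' /(in_desc n_gt0 D_dyadic)[y xy ->].
have [b1 b2] := Bpair k x y j j' xy.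
have sumB k' x' (F : set (n.-tuple R) -> R) :
    (forall P', P' \in desc 1 (cell k' x') -> F P' <= B0) ->
    \sum_(P' <- desc 1 (cell k' x')) F P' <= 1 + (2 ^ n)%:R * Num.max B0 0.
  move=> FB; apply: (@le_trans _ _ (\sum_(P' <- desc 1 (cell k' x')) Num.max B0 0)).
    by rewrite big_seq [leRHS]big_seq; apply: ler_sum => P' /FB ?; rewrite le_max; apply/orP; left.
  rewrite big_const_seq count_predT iter_addr_0 -[leLHS]mulr_natl.
  apply: (le_trans _ (_ : (2 ^ n)%:R * Num.max B0 0 <= _)); last by rewrite lerDr.
  apply: ler_wpM2r => //; rewrite ler_nat.
  by have := size_desc n_gt0 D_dyadic 1 k' x'; rewrite expn1.
split; rewrite /haar_sup mulr_sumr; apply: sumB => P' P'd; first exact: b1.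
by rewrite mulrC; exact: b2.
Qed.

(** The cancelled factor is at least 1 by [haar_L1_sup_ge1]. *)
Lemma balanced_compose k x P Q K1 K2 :
  (forall j j', haar_L1 P j * haar_sup (cell k x) j' <= K1) ->
  (forall j j', haar_L1 (cell k x) j * haar_sup Q j' <= K2) ->
  forall j j', haar_L1 P j * haar_sup Q j' <= K1 * K2.
Proof.
move=> H1 H2 j j'; have := haar_L1_sup_ge1 k x j'.
have := H1 j j'; have := H2 j' j'.
have := haar_L1_ge0 P j; have := haar_sup_ge0 Q j'.
have := haar_L1_ge0 (cell k x) j'; have := haar_sup_ge0 (cell k x) j'.
move: (haar_L1 P j) (haar_sup Q j') (haar_L1 (cell k x) j') (haar_sup (cell k x) j').
move=> a b c d d0 c0 b0 a0 h2 h1 h3.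
apply: (@le_trans _ _ ((a * d) * (c * b))).
  rewrite mulrACA [c * d]mulrC in h3 *.
  have -> : a * c * (d * b) = (a * b) * (d * c) by ring.
  by rewrite ler_peMr// mulr_ge0.
by apply: ler_pM => //; exact: mulr_ge0.
Qed.

(** One climbs from P to the common ancestor and descends to S.  The case r = 0
    also needs a bound on one single cube, which is reached by going down to a
    child and back; this accounts for the exponent m + 2 below. *)
Lemma balanced_descendants r s : exists K : R, 0 <= K /\
  forall k x P S j j', P \in desc r (cell k x) -> S \in desc s (cell k x) ->
    haar_L1 P j * haar_sup S j' <= K.
Proof.
have [B [B1 Bch]] := balanced_children.
have child k y : cell (k + 1%:Z) y \in desc 1 (cell k y).
  by apply: cell_desc => //; exact: in_cell.
have up m k y j j' : haar_L1 (cell (k + m%:Z) y) j * haar_sup (cell k y) j' <= B ^+ m.+2.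
  elim: m j j' => [|m IH].
    rewrite addr0 expr2; apply: (@balanced_compose (k + 1%:Z) y) => j j'.
      by have [] := Bch k y _ j j' (child k y).
    by have [] := Bch k y _ j' j (child k y).
  rewrite exprS; apply: (@balanced_compose (k + m%:Z) y) => // j j'.
  have := child (k + m%:Z) y.
  rewrite (_ : k + m%:Z + 1%:Z = k + m.+1%:Z); last by lia.
  by move=> /Bch - /(_ j' j) [].
have down m k y j j' : haar_L1 (cell k y) j * haar_sup (cell (k + m%:Z) y) j' <= B ^+ m.+2.
  elim: m j j' => [|m IH].
    rewrite addr0 expr2; apply: (@balanced_compose (k + 1%:Z) y) => j j'.
      by have [] := Bch k y _ j j' (child k y).
    by have [] := Bch k y _ j' j (child k y).
  rewrite exprSr; apply: (@balanced_compose (k + m%:Z) y) => // j j'.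
  have := child (k + m%:Z) y.
  rewrite (_ : k + m%:Z + 1%:Z = k + m.+1%:Z); last by lia.
  by move=> /Bch - /(_ j j') [].
have B0 : 0 <= B by exact: le_trans B1.
exists (B ^+ r.+2 * B ^+ s.+2); split; first by rewrite mulr_ge0 ?exprn_ge0.
move=> k x P S j j' /(in_desc n_gt0 D_dyadic)[y xy ->] /(in_desc n_gt0 D_dyadic)[z xz ->].
apply: (@balanced_compose k x) => {}j {}j'.
  by rewrite -(cell_eq D_dyadic xy).
by rewrite -(cell_eq D_dyadic xz).
Qed.

Lemma other_child k x P : P \in desc 1 (cell k x) ->
  exists2 P', P' \in desc 1 (cell k x) & mass P + mass P' <= mass (cell k x).
Proof.
move=> /[dup] Pd /(in_desc n_gt0 D_dyadic)[y xy PE].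
have [z xz nPz] : exists2 z, cell k x z & ~ P z.
  apply: contrapT => no.
  have E : cell k x = P.
    apply/seteqP; split => [z xz|]; last exact: desc_sub Pd.
    by apply: contrapT => nPz; apply: no; exists z.
  by move: E; rewrite PE => /(cell_gen n_gt0 D_dyadic); lia.
exists (cell (k + 1%:Z) z); first exact: cell_desc.
rewrite (mass_desc n_gt0 D_dyadic mu_D 1 k x) (bigD1_seq P)//=; last exact: fset_uniq.
rewrite lerD2l -big_filter (bigD1_seq (cell (k + 1%:Z) z)) /=.
- by rewrite lerDl sumr_ge0// => *; exact: mass_ge0.
- rewrite mem_filter (cell_desc n_gt0 D_dyadic)// andbT.
  by apply/eqP => E; apply: nPz; rewrite -E; exact: in_cell.
- by rewrite filter_uniq // fset_uniq.
Qed.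

Lemma hval_parseval_mass k x P : P \in desc 1 (cell k x) ->
  \sum_j (`|hval (cell k x) j P| * mass P) ^+ 2 =
  mass P * (1 - mass P / mass (cell k x)).
Proof.
move=> Pd; under eq_bigr do rewrite exprMn -normrX ger0_norm ?sqr_ge0//.
rewrite -mulr_suml (hval_parseval n_gt0 D_dyadic mu_D h_haar Pd).
have P0 := mass_desc_gt0 n_gt0 D_dyadic mu_D Pd.
have Q0 := mass_gt0 D_dyadic mu_D k x.
by field; rewrite !gt_eqF.
Qed.

(** Squaring the hypothesis and summing it over all j and j', Parseval gives
    m_P (1 / mu(S) - 1 / mu(Q)) <= (2^n K)^2, where Q is the parent of S and m_P
    is the left-hand side of the conclusion.  This is the claim if S has at
    most half of the mass of Q; otherwise S has a lighter sibling, and the claim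
    for the sibling is stronger. *)
Lemma masses_comparable k x l y K : 0 <= K ->
  (forall j j', haar_L1 (cell k x) j * haar_sup (cell l y) j' <= K) ->
  forall P S, P \in desc 1 (cell k x) -> S \in desc 1 (cell l y) ->
  mass P * (1 - mass P / mass (cell k x)) <= 2 * ((2 ^ n)%:R * K) ^+ 2 * mass S.
Proof.
move=> K0 XK P S Pd; set e := mass P * _; set N : R := (2 ^ n)%:R.
have N0 : 0 <= N by [].
have e0 : 0 <= e.
  rewrite /e -(hval_parseval_mass Pd).
  by apply: sumr_ge0 => j _; exact: sqr_ge0.
have sum_le : forall S, S \in desc 1 (cell l y) ->
    e * ((mass S)^-1 - (mass (cell l y))^-1) <= (N * K) ^+ 2.
  move=> {}S Sd; rewrite -(hval_parseval n_gt0 D_dyadic mu_D h_haar Sd).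
  rewrite /e -(hval_parseval_mass Pd) mulr_suml.
  have cardN : (#|'I_(2 ^ n).-1|%:R : R) <= N.
    by rewrite card_ord ler_nat leq_pred.
  apply: (@le_trans _ _ (\sum_(j : 'I_(2 ^ n).-1) N * K ^+ 2)); last first.
    rewrite sumr_const -mulr_natl exprMn expr2 -!mulrA; apply: ler_wpM2r => //.
    by rewrite mulr_ge0// sqr_ge0.
  apply: ler_sum => j _; rewrite mulr_sumr.
  apply: (@le_trans _ _ (\sum_(j' : 'I_(2 ^ n).-1) K ^+ 2)); last first.
    by rewrite sumr_const -mulr_natl; apply: ler_wpM2r => //; exact: sqr_ge0.
  apply: ler_sum => j' _; rewrite -[hval _ j' _ ^+ 2]ger0_norm ?sqr_ge0//.
  rewrite normrX -exprMn lerXn2r ?nnegrE ?mulr_ge0 ?mass_ge0//.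
  apply: le_trans (XK j j'); apply: ler_pM => //.
  - by rewrite mulr_ge0 ?mass_ge0.
  - exact: haar_L1_ge.
  - exact: haar_sup_ge.
have light S' : S' \in desc 1 (cell l y) -> mass S' <= mass (cell l y) / 2 ->
    e <= 2 * (N * K) ^+ 2 * mass S'.
  move=> S'd S'l; have S'0 := mass_desc_gt0 n_gt0 D_dyadic mu_D S'd.
  have Q0 := mass_gt0 D_dyadic mu_D l y.
  have := sum_le _ S'd.
  have inv : (mass (cell l y))^-1 <= (mass S')^-1 / 2.
    by rewrite -invfM lef_pV2 ?posrE ?mulr_gt0//; lra.
  have : e * ((mass S')^-1 / 2) <= e * ((mass S')^-1 - (mass (cell l y))^-1).
    by apply: ler_wpM2l => //; lra.
  move=> h1 h2; have {h1 h2} := le_trans h1 h2.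
  rewrite mulrA ler_pdivrMr// ler_pdivrMr//.
  by rewrite [(N * K) ^+ 2 * 2]mulrC.
move=> Sd; have [Sl|Sg] := lerP (mass S) (mass (cell l y) / 2); first exact: light.
have [S' S'd S'S] := other_child Sd.
have S'0 := mass_desc_gt0 n_gt0 D_dyadic mu_D S'd.
apply: (@le_trans _ _ (2 * (N * K) ^+ 2 * mass S')); first by apply: light => //; lra.
by apply: ler_wpM2l; [rewrite mulr_ge0 ?sqr_ge0 | lra].
Qed.

End balanced_masses.

Section coefficients.
Context {R : realType} {n : nat} (n_gt0 : (0 < n)%N).
Context (D : int -> set (set (n.-tuple R))) (D_dyadic : dyadic_system D).
Context (mu : {measure set (n.-tuple R) -> \bar R}) (mu_D : dyadic_measure D mu).
Context (h : haar_family R n) (h_haar : haar_system D mu h).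
Context (alpha : R) (alpha_gt0 : 0 < alpha).
Implicit Types (x y : n.-tuple R) (k l : int) (P Q : set (n.-tuple R)).

Local Notation cell := (cell D).
Local Notation desc := (desc D).
Local Notation mass := (mass mu).
Local Notation hval := (hval h).

(** The base of the power is twice the constant of [masses_comparable]. *)
Definition coef_const (K : R) : R :=
  (2 ^ n)%:R * (K * (2 * (2 * ((2 ^ n)%:R * K) ^+ 2)) `^ alpha).

(** Besides local integrability, all that the estimates of T f use of f. *)
Definition jumps_le (f : n.-tuple R -> R) (L : R) : Prop :=
  forall k x, `|average mu (cell (k + 1%:Z) x) f - average mu (cell k x) f| <=
    L * mass (cell (k + 1%:Z) x) `^ alpha.

(** Only the differences of f on the children of P count, since Haar functions
    have mean zero.  They are bounded by the harmonic masses of the children,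
    and those by the mass of S. *)
Lemma haar_coefficient_le (f : n.-tuple R -> R) (L : R) k x l y (K : R) :
  0 <= L -> (forall k x, mu.-integrable (cell k x) (EFin \o f)) -> jumps_le f L ->
  0 <= K ->
  (forall j j', haar_L1 D mu h (cell k x) j * haar_sup D h (cell l y) j' <= K) ->
  forall j j' S, S \in desc 1 (cell l y) ->
    `|inner mu f (h (cell k x) j)| * `|hval (cell l y) j' S| <=
    coef_const K * (L * mass S `^ alpha).
Proof.
move=> L0 fi fL K0 XK j j' S Sd; set Q := cell k x.
pose d P := average mu P f - average mu Q f.
have massP P : P \in desc 1 Q -> 0 < mass P.
  exact: mass_desc_gt0.
have int_mass P : P \in desc 1 Q -> \int[mu]_(z in P) f z = mass P * average mu P f.
  by move=> /massP P0; rewrite /average mulrA divff ?mul1r// gt_eqF.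
have mean0 : \sum_(P <- desc 1 Q) mass P * d P = 0.
  rewrite /d; under eq_bigr do rewrite mulrBr.
  rewrite sumrB -mulr_suml -(mass_desc n_gt0 D_dyadic mu_D 1 k x).
  have -> : mass (cell k x) * average mu Q f = \int[mu]_(z in cell k x) f z.
    by rewrite /average mulrA divff ?mul1r// gt_eqF// mass_gt0.
  rewrite (Rintegral_desc n_gt0 D_dyadic 1)//.
  by apply/eqP; rewrite subr_eq0; apply/eqP; apply: eq_big_seq => P /int_mass.
have dL P : P \in desc 1 Q -> `|d P| <= L * mass P `^ alpha.
  move=> /(in_desc n_gt0 D_dyadic)[z xz ->].
  by rewrite /d /Q -(cell_eq D_dyadic xz); exact: fL.
have := mean_zero_harmonic alpha_gt0 (fset_uniq _) massP mean0 L0 dL.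
rewrite -(mass_desc n_gt0 D_dyadic mu_D 1 k x) => dH.
have S0 := mass_desc_gt0 n_gt0 D_dyadic mu_D Sd.
have -> : inner mu f (h Q j) = \sum_(P <- desc 1 Q) hval Q j P * mass P * d P.
  rewrite (inner_haar n_gt0 D_dyadic h_haar)//.
  transitivity (\sum_(P <- desc 1 Q) (hval Q j P * mass P * d P +
      average mu Q f * (hval Q j P * mass P))).
    by apply: eq_big_seq => P Pd; rewrite int_mass// /d; ring.
  by rewrite big_split /= -mulr_sumr (hval_cancel n_gt0 D_dyadic mu_D h_haar) mulr0 addr0.
pose c := (2 * (2 * ((2 ^ n)%:R * K) ^+ 2)) `^ alpha.
have c0 : 0 <= c by exact: powR_ge0.
have term P : P \in desc 1 Q ->
    `|hval Q j P * mass P * d P| * `|hval (cell l y) j' S| <= K * (L * (c * mass S `^ alpha)).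
  move=> Pd; rewrite 2!normrM (ger0_norm (mass_ge0 _ _)) mulrAC.
  apply: ler_pM => //; first by rewrite !mulr_ge0 ?mass_ge0.
    apply: le_trans (XK j j'); apply: ler_pM => //.
    - by rewrite mulr_ge0 ?mass_ge0.
    - exact: haar_L1_ge.
    - exact: haar_sup_ge.
  apply: (le_trans (dH _ Pd)); apply: ler_wpM2l => //.
  have mS0 : 0 <= mass S by exact: ltW.
  rewrite /c -powRM//; last by rewrite !mulr_ge0 ?sqr_ge0.
  have small := masses_comparable n_gt0 D_dyadic mu_D h_haar K0 XK Pd Sd.
  have e0 : 0 <= mass P * (1 - mass P / mass (cell k x)).
    rewrite -(hval_parseval_mass n_gt0 D_dyadic mu_D h_haar Pd).
    by apply: sumr_ge0 => i _; exact: sqr_ge0.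
  apply: ge0_ler_powR; rewrite ?nnegrE ?(ltW alpha_gt0)//.
  - exact: mulr_ge0.
  - by rewrite !mulr_ge0 ?sqr_ge0.
  - by rewrite -[leRHS]mulrA; apply: ler_wpM2l.
apply: (le_trans (ler_wpM2r (normr_ge0 _) (ler_norm_sum _ _ _))).
rewrite mulr_suml big_seq.
apply: (le_trans (ler_sum _ term)); rewrite -big_seq.
rewrite big_const_seq count_predT iter_addr_0 -[leLHS]mulr_natl.
rewrite /coef_const -/c [leRHS]mulrA.
have -> : (2 ^ n)%:R * (K * c) * L * mass S `^ alpha =
  (2 ^ n)%:R * (K * (L * (c * mass S `^ alpha))) by ring.
apply: ler_wpM2r; first by rewrite !mulr_ge0 ?powR_ge0.
by rewrite ler_nat; have := size_desc n_gt0 D_dyadic 1 k x; rewrite expn1.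
Qed.

End coefficients.

(** * Two-sided series *)

Section two_sided_series.
Context {R : realType}.
Implicit Types (u v : int -> R) (k l : int) (L : R).

(** The split point k of a two-sided series is a parameter, so that it can be
    moved to the generation of the cube on which the series is studied. *)
Definition two_sided u k L := exists L1 L2 : R,
  [/\ series (fun i : nat => u (k + i%:Z)) @ \oo --> L1,
      series (fun i : nat => u (k - i.+1%:Z)) @ \oo --> L2 & L = L1 + L2].

Lemma cvg_series_shift (v : R^nat) (l : R) :
  series (fun i => v i.+1) @ \oo --> l - v 0%N <-> series v @ \oo --> l.
Proof.
have E : series (fun i => v i.+1) = (fun n => series v n.+1 - v 0%N).
  by apply/funext => n; rewrite /series /= big_nat_recl//= addrC addKr.
rewrite E; split => [H|H].
  have := cvgD H (cvg_cst (v 0%N)); rewrite !subrK => H2.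
  by rewrite -(cvg_shiftS (series v)); exact: H2.
have H' : [sequence series v n.+1]_n @ \oo --> l by rewrite cvg_shiftS.
exact: (cvgB H' (cvg_cst (v 0%N))).
Qed.

Lemma two_sidedS u k L : two_sided u k L <-> two_sided u (k + 1) L.
Proof.
have upE : (fun i : nat => u (k + 1 + i%:Z)) = (fun i : nat => u (k + i.+1%:Z)).
  by apply/funext => i; congr u; lia.
have dnE : (fun i : nat => u (k - i.+1%:Z)) = (fun i : nat => u (k + 1 - i.+2%:Z)).
  by apply/funext => i; congr u; lia.
have k0 : u (k + 0%:Z) = u k by rewrite addr0.
have k1 : u (k + 1 - 1%:Z) = u k by rewrite addrK.
split=> -[L1 [L2 [H1 H2 ->]]].
- exists (L1 - u k), (L2 + u k); split; last by rewrite addrACA addNr addr0.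
    by rewrite upE -k0; apply/(cvg_series_shift (fun i : nat => u (k + i%:Z))).
  rewrite dnE in H2.
  apply/(cvg_series_shift (fun i : nat => u (k + 1 - i.+1%:Z))).
  by rewrite k1 addrK.
- exists (L1 + u k), (L2 - u k); split; last by rewrite addrACA subrr addr0.
    apply/(cvg_series_shift (fun i : nat => u (k + i%:Z))).
    by rewrite k0 addrK -upE.
  rewrite dnE -k1.
  by apply/(cvg_series_shift (fun i : nat => u (k + 1 - i.+1%:Z))).
Qed.

Lemma int_shift_invariant (Pr : int -> Prop) :
  (forall k, Pr k <-> Pr (k + 1)) -> forall k l, Pr k -> Pr l.
Proof.
move=> PrS k l.
have shift (m : nat) j : Pr j <-> Pr (j + m%:Z).
  elim: m => [|m IH]; first by rewrite addr0.
  rewrite IH (_ : j + m.+1%:Z = j + m%:Z + 1); last by lia.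
  exact: PrS.
move=> Prk; have [kl|lk] := lerP k l.
  have -> : l = k + `|l - k|%N%:Z by lia.
  exact: (proj1 (shift _ _) Prk).
apply: (proj2 (shift `|k - l|%N l)).
by rewrite (_ : l + `|k - l|%N%:Z = k)//; lia.
Qed.

Lemma two_sided_any u k l L : two_sided u k L -> two_sided u l L.
Proof.
by move: k l; apply: int_shift_invariant => k; exact: two_sidedS.
Qed.

Lemma two_sided_cvg u k l l' :
  cvgn (series (fun i : nat => u (k + i%:Z))) ->
  cvgn (series (fun i : nat => u (l - i.+1%:Z))) ->
  exists L, two_sided u l' L.
Proof.
move=> up down.
have {}up : cvgn (series (fun i : nat => u (0 + i%:Z))).
  move: k 0 up; apply: int_shift_invariant => k.
  rewrite (_ : (fun i : nat => u (k + 1 + i%:Z)) = (fun i : nat => u (k + i.+1%:Z))); last first.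
    by apply/funext => i; congr u; lia.
  split => /cvg_ex [L HL]; apply/cvg_ex.
    by exists (L - u (k + 0%:Z)); apply/(cvg_series_shift (fun i : nat => u (k + i%:Z))).
  exists (L + u (k + 0%:Z)); apply/(cvg_series_shift (fun i : nat => u (k + i%:Z))).
  by rewrite addrK.
have {}down : cvgn (series (fun i : nat => u (0 - i.+1%:Z))).
  move: l 0 down; apply: int_shift_invariant => l.
  rewrite (_ : (fun i : nat => u (l - i.+1%:Z)) = (fun i : nat => u (l + 1 - i.+2%:Z))); last first.
    by apply/funext => i; congr u; lia.
  split => /cvg_ex [L HL]; apply/cvg_ex.
    exists (L + u (l + 1 - 1%:Z)); apply/(cvg_series_shift (fun i : nat => u (l + 1 - i.+1%:Z))).
    by rewrite addrK.
  by exists (L - u (l + 1 - 1%:Z)); apply/(cvg_series_shift (fun i : nat => u (l + 1 - i.+1%:Z))).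
exists (limn (series (fun i : nat => u (0 + i%:Z))) +
  limn (series (fun i : nat => u (0 - i.+1%:Z)))).
apply: (@two_sided_any _ 0).
by exists (limn (series (fun i : nat => u (0 + i%:Z)))),
  (limn (series (fun i : nat => u (0 - i.+1%:Z)))).
Qed.

Lemma two_sided_unique u k L L' : two_sided u k L -> two_sided u k L' -> L = L'.
Proof.
move=> [L1 [L2 [H1 H2 ->]]] [L1' [L2' [H1' H2' ->]]].
by rewrite (cvg_unique _ H1 H1') // (cvg_unique _ H2 H2').
Qed.

Lemma two_sidedB u v k L L' : two_sided u k L -> two_sided v k L' ->
  two_sided (fun i => u i - v i) k (L - L').
Proof.
move=> [L1 [L2 [H1 H2 ->]]] [L1' [L2' [H1' H2' ->]]].
have seriesB (f g : R^nat) : series (fun i => f i - g i) = series f \- series g.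
  by apply/funext => n; rewrite /series /= sumrB.
exists (L1 - L1'), (L2 - L2'); split; last by rewrite opprD addrACA.
  by rewrite (seriesB (fun i : nat => u (k + i%:Z))); exact: cvgB.
by rewrite (seriesB (fun i : nat => u (k - i.+1%:Z))); exact: cvgB.
Qed.

Lemma two_sided_tail u k l L : (forall i, i < k -> u i = 0) ->
  series (fun i : nat => u (k + i%:Z)) @ \oo --> L -> two_sided u l L.
Proof.
move=> u0 H; apply: (@two_sided_any _ k); exists L, 0; split; last by rewrite addr0.
  exact: H.
have -> : (fun i : nat => u (k - i.+1%:Z)) = fun=> 0.
  by apply/funext => i; apply: u0; lia.
have -> : series (fun _ : nat => 0 : R) = cst 0.
  by apply/funext => n; rewrite /series /= big1.
exact: cvg_cst.
Qed.

Lemma two_sided0 u L : two_sided u 0 L ->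
  [/\ cvgn (series (fun i : nat => u i%:Z)),
      cvgn (series (fun i : nat => u (- i.+1%:Z))) &
      limn (series (fun i : nat => u i%:Z)) +
      limn (series (fun i : nat => u (- i.+1%:Z))) = L].
Proof.
move=> [L1 [L2 []]].
have -> : (fun i : nat => u (0 + i%:Z)) = (fun i : nat => u i%:Z).
  by apply/funext => i; rewrite add0r.
have -> : (fun i : nat => u (0 - i.+1%:Z)) = (fun i : nat => u (- i.+1%:Z)).
  by apply/funext => i; rewrite sub0r.
move=> H1 H2 ->; split; [by apply/cvg_ex; exists L1|by apply/cvg_ex; exists L2|].
by rewrite (cvg_lim _ H1)// (cvg_lim _ H2).
Qed.

Lemma cvg_series_telescope (v e : R^nat) (B : R) :
  (forall i, `|v i| <= e i.+1 - e i) -> (forall i, e i <= B) -> cvgn (series v).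
Proof.
move=> ve eB; apply: normed_cvg.
apply: nondecreasing_is_cvgn.
  apply/nondecreasing_seqP => i.
  by rewrite /series /= [leRHS](@big_nat_recr _ _ _ i 0)//= lerDl.
exists (B - e 0%N) => _ [m _ <-]; rewrite /series /=.
apply: (@le_trans _ _ (\sum_(0 <= i < m) (e i.+1 - e i))).
  by apply: ler_sum => i _; exact: ve.
by rewrite telescope_sumr// lerD2r.
Qed.

End two_sided_series.

(** * The martingale Lipschitz seminorm *)

Section lipschitz.
Context {R : realType} {n : nat} (n_gt0 : (0 < n)%N).
Context (D : int -> set (set (n.-tuple R))) (D_dyadic : dyadic_system D).
Context (mu : {measure set (n.-tuple R) -> \bar R}) (mu_D : dyadic_measure D mu).
Context (q alpha : R) (q_gt1 : 1 < q).
Implicit Types (x y : n.-tuple R) (k l : int) (f : n.-tuple R -> R).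

Local Notation cell := (cell D).
Local Notation mass := (mass mu).

Let q_gt0 : 0 < q. Proof. by apply: lt_trans q_gt1. Qed.

Definition box (M : R) : set (n.-tuple R) :=
  [set x : n.-tuple R | forall i, `|tnth x i| <= M].

Lemma measurable_box M : measurable (box M).
Proof.
have -> : box M = \bigcap_(i in [set` 'I_n])
    ((@tnth n R ^~ i) @^-1` `[- M, M]%classic).
  apply/seteqP; split=> x /= h i.
    by move=> _ /=; rewrite in_itv /= -ler_norml; exact: h.
  by have := h i isT; rewrite /= in_itv /= -ler_norml.
apply: fin_bigcap_measurable => // i _.
by rewrite -[X in measurable X]setTI; apply: measurable_tnth.
Qed.

Lemma cell_in_box k x : exists M, cell k x `<=` box M.
Proof.
have [a aE] := dyadic_cube D_dyadic (D_cell D_dyadic k x).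
exists (\sum_i `|tnth a i| + 2 ^ (- k)) => y; rewrite aE => ya i.
have := ya i; rewrite (bigD1 i)//=.
have : 0 <= \sum_(j < n | j != i) `|tnth a j| by apply: sumr_ge0.
have := side_gt0 (R := R) (- k).
have := ler_norm (tnth a i); have := lerNnormlW (lexx `|tnth a i|).
by move=> *; rewrite ler_norml; apply/andP; split; lra.
Qed.

Lemma box_covered M : exists s : seq (n.-tuple R),
  box M `<=` \big[setU/set0]_(x <- s) cell 0 x.
Proof.
pose N := Num.bound (2 * `|M| + 2).
pose F := [set Q | exists2 x, box M x & Q = cell 0 x].
have [|x|finF _] := @cubes_in_box R n D D_dyadic 0 (fun=> - `|M| - 1) N F.
- by move=> _ [x _ ->]; exact: D_cell.
- move=> y i [z Mz ->].
  have [a aE] := dyadic_cube D_dyadic (D_cell D_dyadic 0 z).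
  have := in_cell D_dyadic 0 z; rewrite aE => /(_ i) zi /(_ i) yi.
  have := Mz i; rewrite ler_norml => /andP[z1 z2].
  move: zi yi; rewrite oppr0 expr0z mulr1.
  have : 2 * `|M| + 2 < N%:R.
    by apply: archi_boundP; rewrite addr_ge0// mulr_ge0.
  have := ler_norm M.
  by rewrite -natr1 => *; apply/andP; split; lra.
have /choice [pt ptP] : forall Q, exists x, F Q -> Q = cell 0 x.
  move=> Q; have [[x _ ->]|nF] := pselect (F Q); first by exists x.
  by exists [tuple 0 | i < n].
exists [seq pt Q | Q <- fset_set F] => x Mx.
rewrite big_map -bigcup_seq; exists (cell 0 x).
  by rewrite /= in_fset_set// inE; exists x.
rewrite -ptP; first exact: in_cell.
by exists x.
Qed.

Lemma measurable_powR_norm f (c : R) (A : set (n.-tuple R)) :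
  measurable_fun [set: n.-tuple R] f ->
  measurable_fun A (fun x => (`|f x - c| `^ q)%:E).
Proof.
move=> mf; apply/measurable_EFinP; apply: (@measurable_funS _ _ _ _ setT) => //.
apply: (measurableT_comp (measurable_powR q)).
apply: (measurableT_comp (@normr_measurable R setT)).
exact: measurable_funB.
Qed.

Lemma Lq_locP f : Lq_loc mu q f <->
  measurable_fun [set: n.-tuple R] f /\
  forall k x, (\int[mu]_(y in cell k x) (`|f y| `^ q)%:E < +oo)%E.
Proof.
have pos A : forall x, A x -> (0 <= (`|f x| `^ q)%:E)%E.
  by move=> x _; rewrite lee_fin powR_ge0.
split=> -[mf fin]; split => //.
  move=> k x; have [M cM] := cell_in_box k x.
  apply: le_lt_trans (fin M); apply: ge0_subset_integral => //.
  - exact: measurable_cell.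
  - exact: measurable_box.
  - have := @measurable_powR_norm f 0 (box M) mf.
    by under eq_fun do rewrite subr0.
have mfq A : measurable_fun A (fun x => (`|f x| `^ q)%:E).
  by have := @measurable_powR_norm f 0 A mf; under eq_fun do rewrite subr0.
move=> M; have [s Ms] := box_covered M.
have mU (t : seq (n.-tuple R)) : measurable (\big[setU/set0]_(x <- t) cell 0 x).
  by apply: bigsetU_measurable => x _; exact: measurable_cell.
apply: (@le_lt_trans _ _ (\int[mu]_(y in \big[setU/set0]_(x <- s) cell 0 x) (`|f y| `^ q)%:E)%E).
  by apply: ge0_subset_integral => //; exact: measurable_box.
elim: s {Ms} => [|x s IH]; first by rewrite big_nil integral_set0.
rewrite big_cons; set A := \big[_/_]_(_ <- _) _ in IH *.
have mA : measurable A by exact: mU.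
have mc : measurable (cell 0 x) by exact: measurable_cell.
rewrite (_ : cell 0 x `|` A = cell 0 x `|` (A `\` cell 0 x)); last first.
  by rewrite setDE setUIr setUv setIT.
rewrite ge0_integral_setU //; last 2 first.
- exact: measurableD.
- by rewrite disj_set2E setDE setICA setICr setI0.
apply: lte_add_pinfty => //; apply: le_lt_trans IH.
by apply: ge0_subset_integral => //; exact: measurableD.
Qed.

(** Integrated with lam equal to the L^q average of t, this gives Jensen's
    inequality up to a factor 2. *)
Lemma le_add_powR (t lam : R) : 0 <= t -> 0 < lam ->
  t <= lam + lam `^ (1 - q) * t `^ q.
Proof.
move=> t0 lam0; have [tl|lt] := lerP t lam.
  by apply: (le_trans tl); rewrite lerDl mulr_ge0// powR_ge0.
apply: (@le_trans _ _ (lam `^ (1 - q) * t `^ q)); last by rewrite lerDr ltW.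
have tp : 0 < t by exact: lt_trans lt.
(* 1 - q < 0, so that lam < t gives t^(1-q) <= lam^(1-q). *)
have tE : t `^ (1 - q) * t `^ q = t.
  rewrite -powRD; last by rewrite (gt_eqF tp) implybT.
  by rewrite subrK powRr1// ltW.
rewrite -[leLHS]tE; apply: ler_wpM2r; first exact: powR_ge0.
have -> : 1 - q = - (q - 1) by rewrite opprB.
rewrite !powRN lef_pV2 ?posrE ?powR_gt0//.
by apply: ge0_ler_powR; rewrite ?nnegrE ?(ltW lam0) ?(ltW tp) ?(ltW lt)// subr_ge0 ltW.
Qed.

Lemma integrable_of_Lq f k x : measurable_fun [set: n.-tuple R] f ->
  (\int[mu]_(y in cell k x) (`|f y| `^ q)%:E < +oo)%E ->
  mu.-integrable (cell k x) (EFin \o f).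
Proof.
move=> mf fin; have mc : measurable (cell k x) by exact: measurable_cell.
have mfq A : measurable_fun A (fun x => (`|f x| `^ q)%:E).
  by have := @measurable_powR_norm f 0 A mf; under eq_fun do rewrite subr0.
apply: (@le_integrable _ _ _ mu (cell k x) mc _ (fun y => (1 + `|f y| `^ q)%:E)).
- by apply/measurable_EFinP; exact: measurable_funS mf.
- move=> y _ /=; rewrite lee_fin [leRHS]ger0_norm ?addr_ge0 ?powR_ge0//.
  have := @le_add_powR `|f y| 1 (normr_ge0 _) ltr01.
  by rewrite powR1 /= mul1r.
rewrite (_ : (fun y => _) = (EFin \o cst 1) \+ (fun y => (`|f y| `^ q)%:E)); last first.
  by apply/funext => y; rewrite EFinD.
apply: integrableD => //; first exact: integrable_cst_cell.
apply/integrableP; split => //.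
by under eq_integral => y _ do rewrite gee0_abs ?lee_fin ?powR_ge0//.
Qed.

Lemma norm_term_le (I : \bar R) (m L : R) : (0 <= I)%E -> 0 < m -> 0 <= L ->
  ((((m `^ (q^-1 + alpha))^-1)%:E * I `^ q^-1 <= L%:E) <->
   (I <= ((L * m `^ alpha) `^ q * m)%:E))%E.
Proof.
move=> I0 m0 L0.
have mp : 0 < m `^ (q^-1 + alpha) by exact: powR_gt0.
have E : (L * m `^ alpha) `^ q * m = (L * m `^ (q^-1 + alpha)) `^ q.
  rewrite !powRM ?powR_ge0// -!powRrM mulrDl mulVf ?gt_eqF// -mulrA; congr (_ * _).
  by rewrite [1 + _]addrC powRD ?powRr1 ?(ltW m0)// (gt_eqF m0) implybT.
rewrite E; set B := L * m `^ (q^-1 + alpha).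
have B0 : 0 <= B by rewrite mulr_ge0// ltW.
have -> : (((m `^ (q^-1 + alpha))^-1)%:E * I `^ q^-1 <= L%:E)%E = (I `^ q^-1 <= B%:E)%E.
  by rewrite lee_pdivrMl// -EFinM /B mulrC.
have IE : (I = (I `^ q^-1) `^ q)%E.
  by rewrite -poweRrM mulVf ?gt_eqF// poweRe1.
have BE : (B%:E = (B `^ q)%:E `^ q^-1)%E.
  by rewrite poweR_EFin -powRrM mulfV ?gt_eqF// powRr1.
split => H.
  rewrite IE -poweR_EFin; apply: gt0_ler_poweR => //; first exact: ltW.
    by rewrite in_itv /= leey poweR_ge0.
  by rewrite in_itv /= leey lee_fin B0.
rewrite BE; apply: gt0_ler_poweR => //.
- by rewrite invr_ge0 ltW.
- by rewrite in_itv /= leey I0.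
- by rewrite in_itv /= leey lee_fin powR_ge0.
Qed.

Definition oscillation f k x : \bar R :=
  (\int[mu]_(y in cell (k + 1%:Z) x) (`|f y - average mu (cell k x) f| `^ q)%:E)%E.

Lemma oscillation_ge0 f k x : (0 <= oscillation f k x)%E.
Proof. by apply: integral_ge0 => y _; rewrite lee_fin powR_ge0. Qed.

Lemma parent_cell k x : parent D (cell (k + 1%:Z) x) = cell k x.
Proof. by rewrite /parent ancestor_cell// addrK. Qed.

Lemma lipschitz_norm_le f L : 0 <= L ->
  (lipschitz_norm D mu q alpha f <= L%:E)%E <->
  forall k x, (oscillation f k x <=
    ((L * mass (cell (k + 1%:Z) x) `^ alpha) `^ q * mass (cell (k + 1%:Z) x))%:E)%E.
Proof.
move=> L0; split => [H k x|H].
  apply/norm_term_le => //; first exact: oscillation_ge0.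
    exact: mass_gt0.
  apply: le_trans H; apply: ereal_sup_ubound; exists (cell (k + 1%:Z) x).
    exact: dyadic_cell.
  by rewrite parent_cell.
apply: ge_ereal_sup => _ [Q [k _ DQ] <-].
have [x QE] := cell_ofP D_dyadic DQ.
have kE : k = k - 1%:Z + 1%:Z by rewrite subrK.
rewrite QE kE parent_cell; apply/norm_term_le => //.
- exact: oscillation_ge0.
- exact: mass_gt0.
- exact: H.
Qed.

Lemma lipschitz_norm_ge0 f : (0 <= lipschitz_norm D mu q alpha f)%E.
Proof.
have DQ : dyadic D (cell 0 [tuple 0 | i < n]) by exact: dyadic_cell.
apply: (le_trans _ (ereal_sup_ubound (ex_intro2 _ _ _ DQ erefl))).
by rewrite mule_ge0 ?lee_fin ?invr_ge0 ?powR_ge0 ?poweR_ge0.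
Qed.

(** [le_add_powR] with lam = L mu(Q)^alpha + e / 2; the positive e is needed
    because L may be 0. *)
Lemma lipschitz_jumps f (L : R) :
  lipschitz_space D mu q alpha f -> lipschitz_norm D mu q alpha f = L%:E ->
  (forall k x, mu.-integrable (cell k x) (EFin \o f)) /\
  jumps_le D mu alpha f (2 * L).
Proof.
move=> [/Lq_locP [mf fin] _] LE.
have fi k x : mu.-integrable (cell k x) (EFin \o f) by exact: integrable_of_Lq.
have L0 : 0 <= L by rewrite -lee_fin -LE; exact: lipschitz_norm_ge0.
split=> // k x; set Q := cell (k + 1%:Z) x; set c := average mu (cell k x) f.
have m0 : 0 < mass Q by exact: mass_gt0.
have osc := (lipschitz_norm_le f L0).1 _ k x.
have {}osc : (oscillation f k x <= ((L * mass Q `^ alpha) `^ q * mass Q)%:E)%E.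
  by apply: osc; rewrite LE.
apply/ler_addgt0Pr => e e0; set lam0 := L * mass Q `^ alpha in osc.
pose lam := lam0 + e / 2.
have lam00 : 0 <= lam0 by rewrite mulr_ge0// powR_ge0.
have lamp : 0 < lam by rewrite ltr_wpDl// divr_gt0.
have mQ : measurable Q by exact: measurable_cell.
have ci : mu.-integrable Q (EFin \o cst c) by exact: integrable_cst_cell.
have fci : mu.-integrable Q (EFin \o (fun y => f y - c)).
  by have := integrableB mQ (fi _ _) ci.
have key : (\int[mu]_(y in Q) `|(f y - c)%:E| <= (2 * lam * mass Q)%:E)%E.
  apply: (@le_trans _ _ (\int[mu]_(y in Q) (lam%:E + (lam `^ (1 - q))%:E * (`|f y - c| `^ q)%:E))%E).
    apply: ge0_le_integral => //.
    - by apply: measurableT_comp => //; case/integrableP : fci.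
    - apply: emeasurable_funD => //; apply: emeasurable_funM => //.
      exact: measurable_powR_norm.
    - by move=> y _; rewrite -EFinM -EFinD lee_fin; exact: le_add_powR.
  rewrite ge0_integralD //; last 3 first.
  - by move=> y _; rewrite lee_fin ltW.
  - by move=> y _; rewrite -EFinM lee_fin mulr_ge0 ?powR_ge0.
  - apply: emeasurable_funM => //; exact: measurable_powR_norm.
  rewrite ge0_integralZl_EFin ?powR_ge0 //; last first.
  - exact: measurable_powR_norm.
  rewrite integral_cst// (mu_cell D_dyadic mu_D) -EFinM.
  have : (oscillation f k x <= (lam `^ q * mass Q)%:E)%E.
    apply: (le_trans osc); rewrite lee_fin ler_wpM2r ?(ltW m0)//.
    by apply: ge0_ler_powR; rewrite ?nnegrE ?(ltW lamp) ?(ltW q_gt0)// lerDl divr_ge0// ltW.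
  move/(lee_wpmul2l (_ : 0 <= (lam `^ (1 - q))%:E)%E).
  rewrite lee_fin powR_ge0 => /(_ isT).
  rewrite -EFinM mulrA -powRD ?subrK ?powRr1 ?(ltW lamp)//; last first.
    by rewrite (gt_eqF lamp) implybT.
  move=> H; apply: (le_trans (leeD2l _ H)).
  by rewrite -EFinD lee_fin; lra.
have -> : average mu Q f - c = (mass Q)^-1 * \int[mu]_(y in Q) (f y - c).
  have -> : \int[mu]_(y in Q) (f y - c) = \int[mu]_(y in Q) f y - c * mass Q.
    by rewrite (RintegralB mQ (fi _ _) ci) /= -(Rintegral_cst mu mQ).
  by rewrite mulrBr [c * _]mulrC mulKf ?gt_eqF.
rewrite normrM gtr0_norm ?invr_gt0// ler_pdivrMl//.
apply: (le_trans (le_normr_Rintegral mQ fci)).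
rewrite -lee_fin; apply: (le_trans _ (le_trans key _)).
  rewrite /Rintegral fineK//; apply: integrable_fin_num => //.
  exact: integrable_norm.
by rewrite lee_fin mulrC ler_wpM2l ?(ltW m0)// /lam /lam0; lra.
Qed.

End lipschitz.

(** * Generations of a shift *)

Section shift_generations.
Context {R : realType} {n : nat} (n_gt0 : (0 < n)%N).
Context (D : int -> set (set (n.-tuple R))) (D_dyadic : dyadic_system D).
Context (mu : {measure set (n.-tuple R) -> \bar R}) (mu_D : dyadic_measure D mu).
Context (h : haar_family R n) (h_haar : haar_system D mu h).
Context (r s : nat).
Context (a : set (n.-tuple R) -> set (n.-tuple R) -> set (n.-tuple R) -> R).
Implicit Types (x y : n.-tuple R) (k l : int) (P Q S : set (n.-tuple R)).
Implicit Types (f : n.-tuple R -> R).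

Local Notation cell := (cell D).
Local Notation desc := (desc D).
Local Notation mass := (mass mu).
Local Notation hval := (hval h).
Local Notation gen := (haar_shift_gen D mu h r s a).

Definition shift_coef f Q S : R :=
  \sum_(P <- desc r Q) \sum_j a Q P S * inner mu f (h P j).

Definition haar_sum S x : R := \sum_j h S j x.

(** At x only the output cube containing x contributes, and the coefficients do
    not depend on the indices j and j', so that a generation factorizes. *)
Lemma genE f x k : gen f x k =
  shift_coef f (cell k x) (cell (k + s%:Z) x) * haar_sum (cell (k + s%:Z) x) x.
Proof.
rewrite /haar_shift_gen.
rewrite -(@fsbig_widen _ _ _ _ [set cell k x]); last 2 first.
- by move=> _ ->; exact: D_cell.
- move=> Q /= [DQ nQ]; apply: fsbig1 => P _; apply: fsbig1 => S [[l _ DS] SQ].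
  apply: big1 => j _; apply: big1 => j' _.
  rewrite (haar_support h_haar) ?mulr0//; first by exists (l + s%:Z).
  by move=> /SQ Qx; apply: nQ; exact: cell_unique.
rewrite fsbig_set1 fsbig_finite; last exact: finite_descendants.
rewrite /shift_coef mulr_suml; apply: eq_bigr => P _.
rewrite -(@fsbig_widen _ _ _ _ [set cell (k + s%:Z) x]); last 2 first.
- by move=> _ ->; apply/descendantsP => //; exists x => //; exact: in_cell.
- move=> S /= [/(descendantsP n_gt0 D_dyadic)[y _ ->] nS].
  apply: big1 => j _; apply: big1 => j' _.
  rewrite (haar_out D_dyadic h_haar) ?mulr0// => yx; apply: nS.
  by rewrite (cell_eq _ yx).
rewrite fsbig_set1 /= mulr_suml; apply: eq_bigr => j _.
by rewrite mulr_sumr.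
Qed.

Lemma haar_sum_const k x y z : cell (k + 1%:Z) y z ->
  haar_sum (cell k x) y = haar_sum (cell k x) z.
Proof. by move=> yz; apply: eq_bigr => j _; exact: (haar_eq n_gt0 D_dyadic h_haar). Qed.

Lemma gen_const f k x y : cell (k + s%:Z + 1%:Z) x y -> gen f x k = gen f y k.
Proof.
move=> xy.
have e1 : cell k y = cell k x by apply: cell_eq_le xy => //; lia.
have e2 : cell (k + s%:Z) y = cell (k + s%:Z) x by apply: cell_eq_le xy => //; lia.
by rewrite !genE e1 e2 (haar_sum_const _ xy).
Qed.

Lemma measurable_gen f k : measurable_fun [set: n.-tuple R] (gen f ^~ k).
Proof.
apply: (measurable_const_on_cells D_dyadic (k := k + s%:Z + 1%:Z)) => y z.
exact: gen_const.
Qed.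

Lemma haar_sum_cell k x y : cell k x y ->
  haar_sum (cell k x) y = \sum_j hval (cell k x) j (cell (k + 1%:Z) y).
Proof. by move=> xy; apply: eq_bigr => j _; exact: (haar_cell n_gt0 D_dyadic h_haar). Qed.

Lemma haar_sum_L2 k x :
  \int[mu]_(y in cell k x) (haar_sum (cell k x) y * haar_sum (cell k x) y) =
    ((2 ^ n).-1)%:R /\
  mu.-integrable (cell k x)
    (EFin \o (fun y => haar_sum (cell k x) y * haar_sum (cell k x) y)).
Proof.
have mH : measurable_fun [set: n.-tuple R]
    (fun y => haar_sum (cell k x) y * haar_sum (cell k x) y).
  apply: (measurable_const_on_cells D_dyadic (k := k + 1%:Z)) => y z yz.
  by rewrite (haar_sum_const _ yz).
have iH : mu.-integrable (cell k x)
    (EFin \o (fun y => haar_sum (cell k x) y * haar_sum (cell k x) y)).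
  apply: measurable_bounded_integrable; first exact: measurable_cell.
  - by apply: (dyadic_measure_fin mu_D); exact: dyadic_cell.
  - exact: measurable_funS mH.
  pose M := \sum_j haar_sup D h (cell k x) j.
  have HM y : `|haar_sum (cell k x) y| <= M.
    apply: (le_trans (ler_norm_sum _ _ _)); apply: ler_sum => j _.
    exact: (haar_le n_gt0 D_dyadic h_haar).
  exists (M * M); split; first exact: num_real.
  move=> B MB y _ /=; apply: ltW; apply: le_lt_trans MB.
  by rewrite normrM; apply: ler_pM.
split => //; rewrite (Rintegral_desc n_gt0 D_dyadic 1 iH).
transitivity (\sum_(P <- desc 1 (cell k x)) \sum_j \sum_j'
    hval (cell k x) j P * hval (cell k x) j' P * mass P).
  apply: eq_big_seq => P /(in_desc n_gt0 D_dyadic)[y xy ->].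
  under [RHS]eq_bigr do rewrite -mulr_suml -mulr_sumr.
  rewrite -mulr_suml -mulr_suml -Rintegral_cst; last exact: measurable_cell.
  apply: eq_Rintegral => z; rewrite inE => yz.
  have xz : cell k x z.
    by rewrite -(cell_eq D_dyadic xy); apply: cell_sub yz => //; lia.
  by rewrite haar_sum_cell// (cell_eq _ yz).
rewrite exchange_big /=.
transitivity (\sum_(j : 'I_(2 ^ n).-1) (1 : R)); last by rewrite sumr_const card_ord.
apply: eq_bigr => j _; rewrite exchange_big /= (bigD1 j)//= [X in _ + X]big1.
  by rewrite addr0 (hval_orthonormal n_gt0 D_dyadic mu_D h_haar) eqxx.
move=> j' jj'; rewrite (hval_orthonormal n_gt0 D_dyadic mu_D h_haar).
by rewrite eq_sym (negbTE jj').
Qed.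

Section test_on_haar_function.
Context (k : int) (x y : n.-tuple R) (j : 'I_(2 ^ n).-1).
Hypothesis xy : cell k x y.
Let P := cell (k + r%:Z) y.

Let dyadicP : dyadic D P. Proof. exact: dyadic_cell. Qed.

Lemma gen_haar_off k' z : k' <> k -> gen (h P j) z k' = 0.
Proof.
move=> k'k; rewrite genE /shift_coef big_seq big1 ?mul0r// => P'.
move=> /(in_desc n_gt0 D_dyadic)[y' _ ->].
apply: big1 => j' _; rewrite (haar_orthonormal h_haar) //; last exact: dyadic_cell.
case: eqP => [E|_]; last by rewrite mulr0.
by case: k'k; have := cell_gen n_gt0 D_dyadic E; lia.
Qed.

Lemma gen_haar_on z : cell k x z -> gen (h P j) z k =
  a (cell k x) P (cell (k + s%:Z) z) * haar_sum (cell (k + s%:Z) z) z.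
Proof.
move=> xz; rewrite genE (cell_eq _ xz)//; congr (_ * _).
have Pd : P \in desc r (cell k x) by exact: cell_desc.
rewrite /shift_coef (bigD1_seq P)//=; last exact: fset_uniq.
rewrite (bigD1 j)//= (haar_orthonormal h_haar) // !eqxx mulr1.
rewrite big1 ?addr0; last first.
  move=> j' jj'; rewrite (haar_orthonormal h_haar) // eq_sym (negbTE jj').
  by rewrite andbF mulr0.
rewrite big_seq_cond big1 ?addr0// => P' /andP[+ P'P].
move=> /(in_desc n_gt0 D_dyadic)[y' _ P'E].
apply: big1 => j' _; rewrite (haar_orthonormal h_haar) //; last by rewrite P'E; exact: dyadic_cell.
by rewrite eq_sym (negbTE P'P) mulr0.
Qed.

Lemma haar_shift_haar z : haar_shift D mu h r s a (h P j) z = gen (h P j) z k.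
Proof.
have : two_sided (gen (h P j) z) 0 (gen (h P j) z k).
  apply: (@two_sided_tail _ _ k).
    by move=> i ik; apply: gen_haar_off => E; rewrite E ltxx in ik.
  apply/(cvg_series_shift (fun i : nat => gen (h P j) z (k + i%:Z))).
  rewrite addr0 subrr (_ : series _ = cst 0); first exact: cvg_cst.
  apply/funext => m; rewrite /series /= big1// => i _.
  by apply: gen_haar_off; lia.
by case/two_sided0.
Qed.

End test_on_haar_function.

Lemma norm_sqr_EFin (t : R) : (`|t%:E| `^ 2 = (t * t)%:E)%E.
Proof. by rewrite poweR_EFin -[2]/(2%:R) powR_mulrn// real_normK ?num_real// expr2. Qed.

(** On S the image of h_P^j is the coefficient times the sum of the Haar
    functions of S, whose L^2 norm is at least 1 because n > 0. *)
Lemma coefficients_bounded : L2_bounded mu (haar_shift D mu h r s a) ->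
  exists2 A : R, 0 <= A & forall k x P S,
    P \in desc r (cell k x) -> S \in desc s (cell k x) -> `|a (cell k x) P S| <= A.
Proof.
move=> [C HC]; exists `|C| => // k x P0 S0 /(in_desc n_gt0 D_dyadic)[y xy ->].
move=> /(in_desc n_gt0 D_dyadic)[z xz ->].
set P := cell (k + r%:Z) y; set S := cell (k + s%:Z) z.
have N0 : (0 < (2 ^ n).-1)%N.
  by rewrite -subn1 subn_gt0 -[1%N](expn0 2) ltn_exp2l.
pose j := Ordinal N0; set g := h P j.
have g2 : (\int[mu]_w `|(g w)%:E| `^ 2 = 1)%E.
  under eq_integral do rewrite norm_sqr_EFin.
  (* A real integral equal to 1 is not the default value 0 of an infinite one. *)
  have : inner mu g g = 1.
    by rewrite (haar_orthonormal h_haar) ?eqxx//; exact: dyadic_cell.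
  rewrite /inner /Rintegral; case: (integral _ _ _) => //= [t ->//| |] /esym/eqP;
    by rewrite oner_eq0.
have gN : ('N[mu]_2%:E[EFin \o g] = 1)%E.
  by rewrite unlock g2 poweR1r.
have gL : g \in Lfun mu 2%:E.
  rewrite inE; apply/andP; split; rewrite inE /=.
    exact: (measurable_haar n_gt0 D_dyadic h_haar).
  by rewrite /finite_norm gN ltry.
set T := haar_shift D mu h r s a g.
have TE w : T w = gen g w k by rewrite /T /g /P haar_shift_haar.
have mT : measurable_fun [set: n.-tuple R] T.
  by rewrite (_ : T = gen g ^~ k); [exact: measurable_gen | apply/funext].
have upper : (\int[mu]_w `|(T w)%:E| `^ 2 <= (`|C| `^ 2)%:E)%E.
  rewrite -(poweR_Lnorm mu (EFin \o T)) ?pnatr_eq0//.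
  have := HC g gL; rewrite gN mule1 -/T => TC.
  rewrite -poweR_EFin; apply: gt0_ler_poweR => //.
  - by rewrite in_itv /= leey Lnorm_ge0.
  - by rewrite in_itv /= leey lee_fin normr_ge0.
  - by apply: (le_trans TC); rewrite lee_fin ler_norm.
have [S2 Si] := haar_sum_L2 (k + s%:Z) z.
have mS : measurable S by exact: measurable_cell.
have lower : ((a (cell k x) P S ^+ 2 * ((2 ^ n).-1)%:R)%:E <= \int[mu]_w `|(T w)%:E| `^ 2)%E.
  apply: (@le_trans _ _ (\int[mu]_(w in S) `|(T w)%:E| `^ 2)%E); last first.
    apply: ge0_subset_integral => //; last by move=> w _; exact: poweR_ge0.
    apply: (@measurableT_comp _ _ _ _ _ _ (fun t : \bar R => t `^ 2)%E) => //.
      exact: measurable_poweR.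
    by apply: measurableT_comp => //; apply/measurable_EFinP.
  rewrite -S2 -RintegralZl//.
  rewrite /Rintegral fineK; last first.
    apply: integrable_fin_num => //.
    by under eq_fun do rewrite EFinM; exact: integrableZl.
  rewrite le_eqVlt; apply/orP; left; apply/eqP.
  apply: eq_integral => w; rewrite inE => zw; rewrite norm_sqr_EFin TE.
  have xw : cell k x w.
    rewrite -(cell_eq D_dyadic xz); apply: cell_sub zw => //; lia.
  rewrite /g /P (gen_haar_on j xy xw) (cell_eq _ zw)// -/S -/P.
  by congr EFin; ring.
have := le_trans lower upper; rewrite lee_fin -[2]/(2%:R) powR_mulrn// => aC.
rewrite -ler_sqr ?nnegrE// real_normK ?num_real//; apply: le_trans aC.
by rewrite ler_peMr ?sqr_ge0// ler1n.
Qed.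

End shift_generations.

(** * Fine scales *)

Section fine_scales.
Context {R : realType} {n : nat} (n_gt0 : (0 < n)%N).
Context (D : int -> set (set (n.-tuple R))) (D_dyadic : dyadic_system D).
Context (mu : {measure set (n.-tuple R) -> \bar R}) (mu_D : dyadic_measure D mu).
Context (h : haar_family R n) (h_haar : haar_system D mu h).
Context (alpha : R) (alpha_gt0 : 0 < alpha).
Context (r s : nat).
Context (a : set (n.-tuple R) -> set (n.-tuple R) -> set (n.-tuple R) -> R).
Implicit Types (x y : n.-tuple R) (k l : int) (P Q S : set (n.-tuple R)).

Local Notation cell := (cell D).
Local Notation desc := (desc D).
Local Notation mass := (mass mu).
Local Notation hval := (hval h).
Local Notation gen := (haar_shift_gen D mu h r s a).

Context (A K : R) (A_ge0 : 0 <= A) (K_ge0 : 0 <= K).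
Hypothesis a_le : forall k x P S,
  P \in desc r (cell k x) -> S \in desc s (cell k x) -> `|a (cell k x) P S| <= A.
Hypothesis h_le : forall k x P S j j',
  P \in desc r (cell k x) -> S \in desc s (cell k x) ->
  haar_L1 D mu h P j * haar_sup D h S j' <= K.
Context (f : n.-tuple R -> R) (L : R) (L_ge0 : 0 <= L).
Hypothesis f_int : forall k x, mu.-integrable (cell k x) (EFin \o f).
Hypothesis f_jumps : jumps_le D mu alpha f L.

(** The factors count the cubes P of D_r(Q) and the pairs of indices j, j'. *)
Definition gen_bound : R :=
  ((2 ^ r) ^ n)%:R * ((2 ^ n)%:R * ((2 ^ n)%:R * (A * @coef_const R n alpha K))).

Lemma gen_bound_ge0 : 0 <= gen_bound.
Proof. by rewrite /gen_bound !mulr_ge0 // powR_ge0. Qed.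

Lemma gen_le x k :
  `|gen f x k| <= gen_bound * L * mass (cell (k + s%:Z + 1%:Z) x) `^ alpha.
Proof.
rewrite (genE n_gt0 D_dyadic h_haar) normrM.
set S := cell (k + s%:Z) x; set S' := cell (k + s%:Z + 1%:Z) x.
have xS : S x by exact: in_cell.
have Sd : S \in desc s (cell k x) by apply: cell_desc => //; exact: in_cell.
have S'd : S' \in desc 1 S by exact: cell_desc.
set c := @coef_const R n alpha K * (L * mass S' `^ alpha).
have c0 : 0 <= c by rewrite /c !mulr_ge0 // powR_ge0.
have cN : (#|'I_(2 ^ n).-1|%:R : R) <= (2 ^ n)%:R by rewrite card_ord ler_nat leq_pred.
have termP P : P \in desc r (cell k x) ->
    (\sum_j `|a (cell k x) P S * inner mu f (h P j)|) * `|haar_sum h S x| <=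
    (2 ^ n)%:R * ((2 ^ n)%:R * (A * c)).
  move=> Pd; rewrite mulr_suml.
  apply: (@le_trans _ _ (\sum_(j : 'I_(2 ^ n).-1) (2 ^ n)%:R * (A * c))); last first.
    by rewrite sumr_const -[leLHS]mulr_natl; apply: ler_wpM2r => //; rewrite ?mulr_ge0 ?powR_ge0.
  apply: ler_sum => j _; rewrite normrM.
  apply: (@le_trans _ _ (\sum_(j' : 'I_(2 ^ n).-1) (A * c))); last first.
    by rewrite sumr_const -[leLHS]mulr_natl; apply: ler_wpM2r => //; rewrite ?mulr_ge0 ?powR_ge0.
  rewrite (haar_sum_cell n_gt0 D_dyadic h_haar xS).
  apply: (le_trans (ler_wpM2l _ (ler_norm_sum _ _ _))); first exact: mulr_ge0.
  rewrite mulr_sumr; apply: ler_sum => j' _; rewrite -mulrA.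
  apply: ler_pM => //; [exact: a_le |].
  have /(in_desc n_gt0 D_dyadic)[y _ PE] := Pd.
  rewrite PE; apply: (haar_coefficient_le n_gt0 D_dyadic mu_D h_haar alpha_gt0) => //.
  by move=> i i'; rewrite -PE; exact: h_le Pd Sd.
apply: (@le_trans _ _ (\sum_(P <- desc r (cell k x)) (2 ^ n)%:R * ((2 ^ n)%:R * (A * c)))).
  apply: (@le_trans _ _ ((\sum_(P <- desc r (cell k x))
      \sum_j `|a (cell k x) P S * inner mu f (h P j)|) * `|haar_sum h S x|)).
    apply: ler_wpM2r => //; apply: (le_trans (ler_norm_sum _ _ _)).
    by apply: ler_sum => P _; exact: ler_norm_sum.
  by rewrite mulr_suml big_seq [leRHS]big_seq; apply: ler_sum.
rewrite big_const_seq count_predT iter_addr_0 -[leLHS]mulr_natl.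
have -> : gen_bound * L * mass S' `^ alpha =
    ((2 ^ r) ^ n)%:R * ((2 ^ n)%:R * ((2 ^ n)%:R * (A * c))).
  by rewrite /gen_bound /c; ring.
apply: ler_wpM2r; first by rewrite !mulr_ge0 ?powR_ge0.
by rewrite ler_nat; exact: size_desc.
Qed.

Let M := gen_bound * L.

Let M_ge0 : 0 <= M. Proof. by rewrite mulr_ge0 // gen_bound_ge0. Qed.

Lemma gen_telescopes x k : `|gen f x k| <= M * (tele_const alpha *
  (mass (cell (k + s%:Z) x) `^ alpha - mass (cell (k + s%:Z + 1%:Z) x) `^ alpha)).
Proof.
set S := cell (k + s%:Z) x.
have xS : S x by exact: in_cell.
pose d S' := shift_coef D mu h r a f (cell k x) S * \sum_j hval S j S'.
have dE z : S z -> d (cell (k + s%:Z + 1%:Z) z) = gen f z k.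
  move=> xz; rewrite (genE n_gt0 D_dyadic h_haar) (cell_eq _ xz)//.
  rewrite (_ : cell k z = cell k x); last by apply: cell_eq_le xz => //; lia.
  by rewrite /d -/S (haar_sum_cell n_gt0 D_dyadic h_haar).
rewrite -dE// (mass_desc n_gt0 D_dyadic mu_D 1 (k + s%:Z) x).
apply: (mean_zero_telescopes alpha_gt0) => //; first exact: fset_uniq.
- by move=> P; exact: mass_desc_gt0.
- under eq_bigr do rewrite /d mulrCA mulr_sumr.
  rewrite -mulr_sumr exchange_big /= big1 ?mulr0// => j _.
  under eq_bigr do rewrite mulrC.
  exact: (hval_cancel n_gt0 D_dyadic mu_D h_haar).
- move=> P /(in_desc n_gt0 D_dyadic)[z xz ->].
  by rewrite dE //; exact: gen_le.
- exact: cell_desc.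
Qed.

(** The output cubes of the terms of generation k have generation k + s, so
    that the terms with k >= l - s are those whose output cube is contained in
    the cube of generation l at x. *)
Definition fine_part l x : R :=
  limn (series (fun i : nat => gen f x (l - s%:Z + i%:Z))).

Let e l x (i : nat) := - (M * (tele_const alpha * mass (cell (l + i%:Z) x) `^ alpha)).

Let gen_e l x i : `|gen f x (l - s%:Z + i%:Z)| <= e l x i.+1 - e l x i.
Proof.
apply: (le_trans (gen_telescopes _ _)); rewrite /e.
rewrite (_ : l - s%:Z + i%:Z + s%:Z = l + i%:Z); last by lia.
rewrite (_ : l + i.+1%:Z = l + i%:Z + 1%:Z); last by lia.
by rewrite le_eqVlt; apply/orP; left; apply/eqP; ring.
Qed.

Let e_le0 l x i : e l x i <= 0.
Proof.
by rewrite /e oppr_le0 mulr_ge0// mulr_ge0 ?powR_ge0// ltW// tele_const_gt0.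
Qed.

Lemma fine_part_cvg l x :
  series (fun i : nat => gen f x (l - s%:Z + i%:Z)) @ \oo --> fine_part l x.
Proof. exact: cvg_series_telescope (gen_e l x) (e_le0 l x). Qed.

Lemma gen_cvg k x : cvgn (series (fun i : nat => gen f x (k + i%:Z))).
Proof.
have := @fine_part_cvg (k + s%:Z) x; rewrite addrK => H.
by apply/cvg_ex; eexists; exact: H.
Qed.

Lemma fine_partial_le l x m :
  `|series (fun i : nat => gen f x (l - s%:Z + i%:Z)) m| <=
  M * tele_const alpha * mass (cell l x) `^ alpha.
Proof.
rewrite /series /=; apply: (le_trans (ler_norm_sum _ _ _)).
apply: (@le_trans _ _ (\sum_(0 <= i < m) (e l x i.+1 - e l x i))).
  by apply: ler_sum => i _.
rewrite telescope_sumr//; apply: (@le_trans _ _ (- e l x 0)).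
  by rewrite gerDr e_le0.
by rewrite /e opprK addr0 mulrA.
Qed.

(** The first term is bounded by the mass of the child directly, and the others
    are the beginning of the fine part of the child. *)
Lemma fine_partial_child_le l x m :
  `|series (fun i : nat => gen f x (l - s%:Z + i%:Z)) m| <=
  M * (1 + tele_const alpha) * mass (cell (l + 1%:Z) x) `^ alpha.
Proof.
have T0 := tele_const_gt0 alpha_gt0.
case: m => [|m].
  rewrite /series /= big_geq// normr0 !mulr_ge0 ?powR_ge0//.
  by rewrite addr_ge0// ltW.
rewrite /series /= big_nat_recl//= addr0.
have -> : \sum_(0 <= i < m) gen f x (l - s%:Z + i.+1%:Z) =
    series (fun i : nat => gen f x (l + 1%:Z - s%:Z + i%:Z)) m.
  by rewrite /series /=; apply: eq_bigr => i _; congr gen; lia.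
apply: (le_trans (ler_normD _ _)).
apply: (le_trans (lerD (gen_le _ _) (fine_partial_le _ _ _))).
rewrite subrK -/M.
by rewrite le_eqVlt; apply/orP; left; apply/eqP; ring.
Qed.

Lemma fine_part_le l x : `|fine_part l x| <= M * tele_const alpha * mass (cell l x) `^ alpha.
Proof.
have H : `|series (fun i : nat => gen f x (l - s%:Z + i%:Z)) m| @[m --> \oo] -->
    `|fine_part l x| by apply: cvg_norm; exact: fine_part_cvg.
rewrite -(cvg_lim _ H)//; apply: limr_le; first by apply/cvg_ex; eexists; exact: H.
by apply: nearW => m; exact: fine_partial_le.
Qed.

Lemma fine_part_child_le l x :
  `|fine_part l x| <= M * (1 + tele_const alpha) * mass (cell (l + 1%:Z) x) `^ alpha.
Proof.
have H : `|series (fun i : nat => gen f x (l - s%:Z + i%:Z)) m| @[m --> \oo] -->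
    `|fine_part l x| by apply: cvg_norm; exact: fine_part_cvg.
rewrite -(cvg_lim _ H)//; apply: limr_le; first by apply/cvg_ex; eexists; exact: H.
by apply: nearW => m; exact: fine_partial_child_le.
Qed.

Lemma measurable_fine_part l : measurable_fun [set: n.-tuple R] (fine_part l).
Proof.
apply: (measurable_fun_cvg (h := fun m x =>
    series (fun i : nat => gen f x (l - s%:Z + i%:Z)) m)).
  move=> m; rewrite /series /=; apply: measurable_sum => i.
  exact: (measurable_gen n_gt0 D_dyadic h_haar).
by move=> x _; exact: fine_part_cvg.
Qed.

Lemma Rintegral_haar_sum k x :
  mu.-integrable (cell k x) (EFin \o haar_sum h (cell k x)) /\
  \int[mu]_(y in cell k x) haar_sum h (cell k x) y = 0.
Proof.
have ih : mu.-integrable (cell k x) (EFin \o haar_sum h (cell k x)).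
  rewrite (_ : EFin \o _ = (fun y => \sum_(j <- enum 'I_(2 ^ n).-1) (EFin \o h (cell k x) j) y)%E).
    apply: integrable_sum => [|j _]; first exact: measurable_cell.
    exact: (integrable_haar n_gt0 D_dyadic mu_D h_haar).
  by apply/funext => y /=; rewrite sumEFin big_enum.
split => //; rewrite (Rintegral_desc n_gt0 D_dyadic 1 ih).
transitivity (\sum_(P <- desc 1 (cell k x)) \sum_j hval (cell k x) j P * mass P).
  apply: eq_big_seq => P /(in_desc n_gt0 D_dyadic)[y xy ->].
  rewrite -mulr_suml -Rintegral_cst; last exact: measurable_cell.
  apply: eq_Rintegral => z; rewrite inE => yz.
  have xz : cell k x z.
    by rewrite -(cell_eq D_dyadic xy); apply: cell_sub yz => //; lia.
  by rewrite (haar_sum_cell n_gt0 D_dyadic h_haar xz) (cell_eq _ yz).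
rewrite exchange_big big1 // => j _.
exact: (hval_cancel n_gt0 D_dyadic mu_D h_haar).
Qed.

Lemma integrable_gen l x k : l <= k + s%:Z ->
  mu.-integrable (cell l x) (EFin \o gen f ^~ k).
Proof.
move=> lk; apply: measurable_bounded_integrable; first exact: measurable_cell.
- by apply: (dyadic_measure_fin mu_D); exact: dyadic_cell.
- by apply: (@measurable_funS _ _ _ _ setT) => //; exact: (measurable_gen n_gt0 D_dyadic h_haar).
exists (M * mass (cell l x) `^ alpha); split; first exact: num_real.
move=> B MB y xy /=; apply: ltW; apply: le_lt_trans MB.
apply: (le_trans (gen_le _ _)); apply: ler_wpM2l => //.
apply: ge0_ler_powR; rewrite ?nnegrE ?mass_ge0 ?(ltW alpha_gt0)//.
by rewrite -(cell_eq D_dyadic xy); apply: mass_le => //; lia.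
Qed.

Lemma Rintegral_gen l x k : l <= k + s%:Z ->
  \int[mu]_(y in cell l x) gen f y k = 0.
Proof.
move=> lk; have [m mE] : exists m : nat, k + s%:Z = l + m%:Z.
  by exists (absz (k + s%:Z - l)%R); lia.
rewrite (Rintegral_desc n_gt0 D_dyadic m); last exact: integrable_gen.
rewrite big_seq big1 // => S /(in_desc n_gt0 D_dyadic)[y xy ->]; rewrite -mE.
have [ih i0] := Rintegral_haar_sum (k + s%:Z) y.
transitivity (\int[mu]_(z in cell (k + s%:Z) y)
    (shift_coef D mu h r a f (cell k y) (cell (k + s%:Z) y) * haar_sum h (cell (k + s%:Z) y) z)).
  apply: eq_Rintegral => z; rewrite inE => yz.
  rewrite (genE n_gt0 D_dyadic h_haar) (cell_eq _ yz)//.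
  by rewrite (_ : cell k z = cell k y)//; apply: cell_eq_le yz => //; lia.
by rewrite RintegralZl ?i0 ?mulr0//; exact: measurable_cell.
Qed.

(** Dominated convergence: the partial sums of the fine part have integral zero
    and are bounded by their total variation. *)
Lemma Rintegral_fine_part l x :
  mu.-integrable (cell l x) (EFin \o fine_part l) /\
  \int[mu]_(y in cell l x) fine_part l y = 0.
Proof.
pose ps (m : nat) y := series (fun i : nat => gen f y (l - s%:Z + i%:Z)) m.
pose B := M * tele_const alpha * mass (cell l x) `^ alpha.
have mc : measurable (cell l x) by exact: measurable_cell.
have psE m : EFin \o ps m = (fun y => \sum_(i <- iota 0 m) (gen f y (l - s%:Z + i%:Z)%R)%:E)%E.
  by apply/funext => y /=; rewrite sumEFin /ps /series /= /index_iota subn0.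
have gi i : mu.-integrable (cell l x) (EFin \o gen f ^~ (l - s%:Z + i%:Z)).
  by apply: integrable_gen; lia.
have psi m : mu.-integrable (cell l x) (EFin \o ps m).
  by rewrite psE; apply: integrable_sum => // i _; exact: gi.
have [] := @dominated_convergence _ _ _ mu (cell l x) mc (fun m => EFin \o ps m)
  (EFin \o fine_part l) (EFin \o cst B).
- by move=> m; case/integrableP : (psi m).
- by apply/measurable_EFinP; apply: measurable_funS (measurable_fine_part l).
- apply: aeW => y _; apply/fine_cvgP; split; first exact: nearW.
  exact: fine_part_cvg.
- exact: integrable_cst_cell.
- apply: aeW => y m xy /=; rewrite lee_fin /B -(cell_eq D_dyadic xy).
  exact: fine_partial_le.
move=> fi _ lim; split => //.
have ps0 m : (\int[mu]_(y in cell l x) (EFin \o ps m) y = 0)%E.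
  rewrite psE integral_sum//; apply: big1_seq => i _.
  have := @Rintegral_gen l x (l - s%:Z + i%:Z).
  rewrite /Rintegral => H; rewrite -[LHS]fineK ?H//; first by lia.
  exact: (integrable_fin_num mc (gi i)).
have : [sequence (\int[mu]_(y in cell l x) (EFin \o ps m) y)%E]_m @ \oo --> (0%E : \bar R).
  rewrite (_ : [sequence _]_m = cst 0%E); first exact: cvg_cst.
  by apply/funext => m; exact: ps0.
move=> lim0; rewrite /Rintegral.
have -> : (\int[mu]_(y in cell l x) (fine_part l y)%:E = 0)%E.
  exact: (cvg_unique _ lim lim0).
by [].
Qed.

End fine_scales.

(** * Coarse scales *)

Section coarse_scales.
Context {R : realType} {n : nat} (n_gt0 : (0 < n)%N).
Context (D : int -> set (set (n.-tuple R))) (D_dyadic : dyadic_system D).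
Context (mu : {measure set (n.-tuple R) -> \bar R}) (mu_D : dyadic_measure D mu).
Context (h : haar_family R n) (h_haar : haar_system D mu h).
Context (r s : nat).
Context (a : set (n.-tuple R) -> set (n.-tuple R) -> set (n.-tuple R) -> R).
Implicit Types (x y : n.-tuple R) (k l : int) (P Q S : set (n.-tuple R)).
Implicit Types (f g : n.-tuple R -> R).

Local Notation cell := (cell D).
Local Notation desc := (desc D).
Local Notation mass := (mass mu).
Local Notation hval := (hval h).
Local Notation gen := (haar_shift_gen D mu h r s a).

Lemma inner_eq_on g1 g2 k x j : (forall y, cell k x y -> g1 y = g2 y) ->
  inner mu g1 (h (cell k x) j) = inner mu g2 (h (cell k x) j).
Proof.
move=> g12; apply: eq_Rintegral => y _.
have [xy|nxy] := pselect (cell k x y); first by rewrite g12.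
by rewrite (haar_out D_dyadic h_haar j nxy) !mulr0.
Qed.

Lemma gen_eq_on g1 g2 k x : (forall y, cell k x y -> g1 y = g2 y) ->
  gen g1 x k = gen g2 x k.
Proof.
move=> g12; rewrite !(genE n_gt0 D_dyadic h_haar); congr (_ * _).
apply: eq_big_seq => P /(in_desc n_gt0 D_dyadic)[y xy ->].
apply: eq_bigr => j _; congr (_ * _); apply: inner_eq_on => z yz; apply: g12.
by rewrite -(cell_eq D_dyadic xy); apply: cell_sub yz => //; lia.
Qed.

Definition localize f l x : n.-tuple R -> R := f \* \1_(cell l x).

Lemma localizeE f l x y : cell l x y -> localize f l x y = f y.
Proof. by move=> xy; rewrite /localize /= indicE mem_set// mulr1. Qed.

(** Both points lie in the same child of the output cube. *)
Lemma gen_coarse g l x0 x k : cell l x0 x -> k < l - s%:Z ->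
  gen g x k = gen g x0 k.
Proof.
move=> xx k_lt; apply/esym; apply: (gen_const n_gt0 D_dyadic h_haar).
by apply: cell_sub xx => //; lia.
Qed.

Lemma haar_sqr k x :
  \sum_j h (cell k x) j x ^+ 2 = (mass (cell (k + 1%:Z) x))^-1 - (mass (cell k x))^-1.
Proof.
rewrite -(hval_parseval n_gt0 D_dyadic mu_D h_haar); last first.
  by apply: cell_desc => //; exact: in_cell.
by apply: eq_bigr => j _; rewrite (haar_cell n_gt0 D_dyadic h_haar)//; exact: in_cell.
Qed.

Lemma inner_localize f l x k y j : mu.-integrable (cell l x) (EFin \o f) -> k < l ->
  inner mu (localize f l x) (h (cell k y) j) =
  h (cell k y) j x * \int[mu]_(z in cell l x) f z.
Proof.
move=> fi kl; rewrite mulrC -RintegralZr//; last exact: measurable_cell.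
rewrite [RHS]Rintegral_mkcond; apply: eq_Rintegral => z _; rewrite patchE.
case: ifPn => [|/negP]; rewrite inE => xz.
  rewrite localizeE//; congr (_ * _); apply/esym; apply: (haar_eq n_gt0 D_dyadic h_haar).
  by apply: cell_sub xz => //; lia.
by rewrite /localize /= indicE memNset// mulr0 mul0r.
Qed.

Context (A : R) (A_ge0 : 0 <= A).
Hypothesis a_le : forall k x P S,
  P \in desc r (cell k x) -> S \in desc s (cell k x) -> `|a (cell k x) P S| <= A.

Let inv_mass x k := (mass (cell k x))^-1.

(** A Haar function of a cube larger than the support of the localized f is
    constant on that support.  Hence only the ancestor of x contributes, with
    products u_j w_j' of values of Haar functions at x; these are at most
    u_j^2 + w_j'^2, and Parseval turns the squares into differences of 1 / mu
    which telescope over k. *)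
Lemma gen_localize_le f l x k : mu.-integrable (cell l x) (EFin \o f) ->
  k + r%:Z < l ->
  `|gen (localize f l x) x k| <=
  A * `|\int[mu]_(z in cell l x) f z| * (2 ^ n)%:R *
    ((inv_mass x (k + r%:Z + 1%:Z) - inv_mass x (k + r%:Z)) +
     (inv_mass x (k + s%:Z + 1%:Z) - inv_mass x (k + s%:Z))).
Proof.
move=> fi kl; set I := \int[mu]_(z in _) _.
rewrite (genE n_gt0 D_dyadic h_haar) normrM.
set S := cell (k + s%:Z) x; set P := cell (k + r%:Z) x.
have Sd : S \in desc s (cell k x) by apply: cell_desc => //; exact: in_cell.
have Pd : P \in desc r (cell k x) by apply: cell_desc => //; exact: in_cell.
have cE : shift_coef D mu h r a (localize f l x) (cell k x) S =
    \sum_j a (cell k x) P S * (h P j x * I).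
  rewrite /shift_coef (bigD1_seq P)//=; last exact: fset_uniq.
  rewrite [X in _ + X]big_seq_cond [X in _ + X]big1 ?addr0; last first.
    move=> P' /andP[/(in_desc n_gt0 D_dyadic)[y xy ->] /eqP P'P].
    apply: big1 => j _; rewrite inner_localize//.
    rewrite (haar_out D_dyadic h_haar) ?mul0r ?mulr0// => yx; apply: P'P.
    by rewrite -(cell_eq D_dyadic yx).
  by apply: eq_bigr => j _; rewrite inner_localize.
have c_le : `|shift_coef D mu h r a (localize f l x) (cell k x) S| <=
    A * `|I| * \sum_j `|h P j x|.
  rewrite cE mulr_sumr; apply: (le_trans (ler_norm_sum _ _ _)).
  apply: ler_sum => j _; rewrite 2!normrM [X in _ * X]mulrC mulrA.
  by do 2!apply: ler_wpM2r => //; exact: a_le.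
apply: (le_trans (ler_pM _ _ c_le (ler_norm_sum _ _ _))) => //.
rewrite -!mulrA; do 2!apply: ler_wpM2l => //.
rewrite -!haar_sqr -/P -/S.
have cN : ((2 ^ n).-1%:R : R) <= (2 ^ n)%:R by rewrite ler_nat leq_pred.
apply: (@le_trans _ _ (((2 ^ n).-1)%:R *
   (\sum_j h P j x ^+ 2 + \sum_j h S j x ^+ 2))); last first.
  by apply: ler_wpM2r => //; rewrite addr_ge0// sumr_ge0// => j _; exact: sqr_ge0.
rewrite mulr_suml.
apply: (@le_trans _ _ (\sum_j \sum_j' (h P j x ^+ 2 + h S j' x ^+ 2))).
  apply: ler_sum => j _; rewrite mulr_sumr; apply: ler_sum => j' _.
  rewrite -[h P j x ^+ 2]real_normK ?num_real// -[h S j' x ^+ 2]real_normK ?num_real//.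
  have := normr_ge0 (h P j x); have := normr_ge0 (h S j' x).
  move: `|h P j x| `|h S j' x| => u w w0 u0.
  by have := sqr_ge0 (u - w); nra.
under eq_bigr do rewrite big_split /= sumr_const card_ord.
by rewrite big_split /= sumr_const card_ord sumrMnl -mulrnDl mulr_natl.
Qed.

Context (alpha : R) (alpha_gt0 : 0 < alpha).
Context (K : R) (K_ge0 : 0 <= K).
Hypothesis h_le : forall k x P S j j',
  P \in desc r (cell k x) -> S \in desc s (cell k x) ->
  haar_L1 D mu h P j * haar_sup D h S j' <= K.
Context (f : n.-tuple R -> R) (L : R) (L_ge0 : 0 <= L).
Hypothesis f_int : forall k x, mu.-integrable (cell k x) (EFin \o f).
Hypothesis f_jumps : jumps_le D mu alpha f L.

Local Notation fine_part := (fine_part D mu h r s a f).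
Local Notation T := (haar_shift D mu h r s a).
Local Notation f_on l x := (localize f (l - (r + s)%:Z) x).

Lemma gen_f_cvg k x : cvgn (series (fun i : nat => gen f x (k + i%:Z))).
Proof.
exact: (gen_cvg n_gt0 D_dyadic mu_D h_haar alpha_gt0 A_ge0 K_ge0 a_le h_le
  L_ge0 f_int f_jumps).
Qed.

Lemma fine_cvg l x :
  series (fun i : nat => gen f x (l - s%:Z + i%:Z)) @ \oo --> fine_part l x.
Proof.
exact: (fine_part_cvg n_gt0 D_dyadic mu_D h_haar alpha_gt0 A_ge0 K_ge0 a_le h_le
  L_ge0 f_int f_jumps).
Qed.

Lemma gen_f_on l x0 x k : cell l x0 x -> l - s%:Z <= k ->
  gen (f_on l x0) x k = gen f x k.
Proof.
move=> xx lk; apply: gen_eq_on => y xy; apply: localizeE.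
rewrite -(cell_eq_le n_gt0 D_dyadic (_ : l - (r + s)%:Z <= l) xx); last by lia.
by apply: cell_sub xy => //; lia.
Qed.

Lemma localized_cvg l x0 x : cell l x0 x ->
  haar_shift_cvg D mu h r s a (f_on l x0) x /\
  two_sided (gen (f_on l x0) x) 0 (T (f_on l x0) x).
Proof.
move=> xx; set u := gen (f_on l x0) x.
suff [M uM] : exists M, two_sided u 0 M.
  by have [c1 c2 ME] := two_sided0 uM; rewrite /haar_shift ME.
(* Below k1 the cubes P are larger than the support of the localized f. *)
pose k1 := l - (r + s)%:Z - r%:Z.
apply: (two_sided_cvg (k := l - s%:Z) (l := k1)).
  rewrite (_ : (fun i : nat => _) = (fun i : nat => gen f x (l - s%:Z + i%:Z))).
    exact: gen_f_cvg.
  by apply/funext => i; rewrite /u gen_f_on//; lia.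
rewrite (_ : (fun i : nat => _) = (fun i : nat => gen (f_on l x0) x0 (k1 - i.+1%:Z))); last first.
  by apply/funext => i; rewrite /u (gen_coarse _ xx)// /k1; lia.
set c := A * `|\int[mu]_(z in cell (l - (r + s)%:Z) x0) f z| * (2 ^ n)%:R.
have c0 : 0 <= c by rewrite /c !mulr_ge0.
pose e (i : nat) := - (c * (inv_mass x0 (k1 - i%:Z + r%:Z) + inv_mass x0 (k1 - i%:Z + s%:Z))).
apply: (@cvg_series_telescope _ _ e 0) => i; last first.
  by rewrite /e oppr_le0 mulr_ge0// addr_ge0// invr_ge0 mass_ge0.
apply: (le_trans (gen_localize_le _ _)) => //; first by rewrite /k1; lia.
rewrite -/c /e.
rewrite (_ : k1 - i.+1%:Z + r%:Z + 1%:Z = k1 - i%:Z + r%:Z); last by lia.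
rewrite (_ : k1 - i.+1%:Z + s%:Z + 1%:Z = k1 - i%:Z + s%:Z); last by lia.
by rewrite le_eqVlt; apply/orP; left; apply/eqP; ring.
Qed.

(** The series at two points of one cube are compared term by term, because the
    coarse terms cancel before they are summed.  The same statement serves for
    the localized series and for the normalized one. *)
Lemma two_sided_fine l x y (u v : int -> R) Lu Lv :
  two_sided u 0 Lu -> two_sided v 0 Lv ->
  (forall k, k < l - s%:Z -> u k = v k) ->
  (forall k, l - s%:Z <= k -> u k - v k = gen f x k - gen f y k) ->
  Lu - Lv = fine_part l x - fine_part l y.
Proof.
move=> uL vL lo hi; apply: (two_sided_unique (two_sidedB uL vL)).
apply: (@two_sided_tail _ _ (l - s%:Z)).
  by move=> k kl; rewrite lo// subrr.
rewrite (_ : series _ = series (fun i : nat => gen f x (l - s%:Z + i%:Z)) -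
    series (fun i : nat => gen f y (l - s%:Z + i%:Z))).
  by apply: cvgB; exact: fine_cvg.
apply/funext => m; rewrite fctE /series /= -sumrB; apply: eq_bigr => i _.
by rewrite hi//; lia.
Qed.

Lemma haar_shift_fine l x0 x : cell l x0 x ->
  T (f_on l x0) x - T (f_on l x0) x0 = fine_part l x - fine_part l x0.
Proof.
move=> xx; have x0x0 : cell l x0 x0 by exact: in_cell.
have [_ u] := localized_cvg xx; have [_ v] := localized_cvg x0x0.
apply: (two_sided_fine u v) => k kl; first exact: (gen_coarse _ xx).
by rewrite !gen_f_on.
Qed.

Lemma f_onE l x : f \* \1_(ancestor D (r + s) (cell l x)) = f_on l x.
Proof. by rewrite ancestor_cell. Qed.

(** Cubes of all generations around x exhaust the quadrant of x, so that the
    choice depends on this quadrant only. *)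
Definition base_point x : n.-tuple R :=
  xget [tuple 0 | i < n] [set y | exists k, cell k x y].

Lemma base_pointP x : exists k, cell k x (base_point x).
Proof.
apply: (@xgetPex _ _ [set y | exists k, cell k x y]).
by exists x, 0; exact: in_cell.
Qed.

Lemma base_point_cell l x y : cell l x y -> base_point x = base_point y.
Proof.
move=> xy; rewrite /base_point; congr xget; apply/seteqP.
have E m : m <= l -> cell m y = cell m x by move=> ml; apply: cell_eq_le xy.
split=> z /= [k kz]; exists (Num.min k l); rewrite ?E ?ge_min ?lexx ?orbT//.
  by apply: cell_sub kz => //; rewrite ge_min lexx.
rewrite -E ?ge_min ?lexx ?orbT//.
by apply: cell_sub kz => //; rewrite ge_min lexx.
Qed.

(** The coarse terms of T f need not be summable, but those with k < 0 are
    constant on larger and larger cubes; once their value at the base point is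
    subtracted, only finitely many of them are nonzero at x. *)
Definition normalized_gen x k : R :=
  gen f x k - gen f (base_point x) k *+ (k < 0 :> int).

Definition normalized_shift x : R :=
  limn (series (fun i : nat => normalized_gen x i%:Z)) +
  limn (series (fun i : nat => normalized_gen x (- i.+1%:Z))).

Lemma normalized_cvg x : two_sided (normalized_gen x) 0 (normalized_shift x).
Proof.
suff [M uM] : exists M, two_sided (normalized_gen x) 0 M.
  by have [_ _ ME] := two_sided0 uM; rewrite /normalized_shift ME.
have [k0 k0P] := base_pointP x.
pose k1 := Num.min 0 (k0 - s%:Z).
apply: (two_sided_cvg (k := 0) (l := k1)).
  rewrite (_ : (fun i : nat => _) = (fun i : nat => gen f x (0 + i%:Z))).
    exact: gen_f_cvg.
  apply/funext => i; rewrite /normalized_gen (_ : (0 + i%:Z < 0) = false) ?subr0//.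
rewrite (_ : (fun i : nat => _) = (fun=> 0)).
  apply/cvg_ex; exists 0; rewrite (_ : series _ = cst 0); first exact: cvg_cst.
  by apply/funext => m; rewrite /series /= big1.
apply/funext => i; rewrite /normalized_gen (_ : (k1 - i.+1%:Z < 0) = true) ?mulr1n; last by rewrite /k1; lia.
by rewrite (gen_coarse f k0P) ?subrr//; rewrite /k1; lia.
Qed.

Lemma normalized_shift_fine l x0 x : cell l x0 x ->
  normalized_shift x - normalized_shift x0 = fine_part l x - fine_part l x0.
Proof.
move=> xx; have bE := base_point_cell xx.
apply: (two_sided_fine (normalized_cvg x) (normalized_cvg x0)) => k kl;
  rewrite /normalized_gen bE.
  by rewrite (gen_coarse f xx kl).
by rewrite opprB addrA subrK.
Qed.

Lemma measurable_normalized_shift : measurable_fun [set: n.-tuple R] normalized_shift.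
Proof.
have mgen k : measurable_fun [set: n.-tuple R] (normalized_gen ^~ k).
  apply: measurable_funB; first exact: (measurable_gen n_gt0 D_dyadic h_haar).
  apply: (measurable_const_on_cells D_dyadic (k := 0)) => x y xy.
  by rewrite (base_point_cell xy).
apply: (measurable_fun_cvg (h := fun m x =>
    series (fun i : nat => normalized_gen x i%:Z) m +
    series (fun i : nat => normalized_gen x (- i.+1%:Z)) m)).
  by move=> m; apply: measurable_funD; rewrite /series /=; apply: measurable_sum => i; exact: mgen.
move=> x _; have [c1 c2 _] := two_sided0 (normalized_cvg x).
exact: (cvgD c1 c2).
Qed.

Lemma haar_shift_image_exists : haar_shift_image D mu h r s a f normalized_shift.
Proof.
split; first exact: measurable_normalized_shift.
move=> _ [l _ /(cell_ofP D_dyadic)[x0 ->]] f0.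
have -> : f0 = f_on l x0 by exact: f_onE.
exists (normalized_shift x0 - T (f_on l x0) x0); apply: aeW => x xx; split.
  by have [] := localized_cvg xx.
have := haar_shift_fine xx; have := normalized_shift_fine xx; lra.
Qed.

Lemma haar_shift_image_fine F l x0 : haar_shift_image D mu h r s a f F ->
  exists c, {ae mu, forall x, cell l x0 x -> F x = c + fine_part l x}.
Proof.
move=> [_ /(_ (cell l x0) (dyadic_cell D_dyadic l x0)) [c]].
rewrite f_onE => cP; exists (c + T (f_on l x0) x0 - fine_part l x0).
apply: filterS cP => x xP xx; have [_ E] := xP xx.
have := haar_shift_fine xx; lra.
Qed.

End coarse_scales.

(** * The seminorm of the image *)

Section image_norm.
Context {R : realType} {n : nat} (n_gt0 : (0 < n)%N).
Context (D : int -> set (set (n.-tuple R))) (D_dyadic : dyadic_system D).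
Context (mu : {measure set (n.-tuple R) -> \bar R}) (mu_D : dyadic_measure D mu).
Context (q alpha : R) (q_gt1 : 1 < q).
Implicit Types (x y : n.-tuple R) (k l : int).

Local Notation cell := (cell D).
Local Notation mass := (mass mu).

(** Mean zero makes the constant c the average of F over the cube, and then the
    bound by the mass of the child is the seminorm estimate.  The bound by the
    mass of the cube itself only serves local integrability. *)
Lemma lipschitz_of_decomposition (F : n.-tuple R -> R) (Phi : int -> n.-tuple R -> R)
    (B M : R) :
  measurable_fun [set: n.-tuple R] F -> 0 <= B -> 0 <= M ->
  (forall l x, exists c, {ae mu, forall y, cell l x y -> F y = c + Phi l y}) ->
  (forall l x, mu.-integrable (cell l x) (EFin \o Phi l) /\
     \int[mu]_(y in cell l x) Phi l y = 0) ->
  (forall l x, `|Phi l x| <= B * mass (cell l x) `^ alpha) ->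
  (forall l x, `|Phi l x| <= M * mass (cell (l + 1%:Z) x) `^ alpha) ->
  lipschitz_space D mu q alpha F /\ (lipschitz_norm D mu q alpha F <= M%:E)%E.
Proof.
move=> mF B0 M0 F_dec Phi_int Phi_le Phi_child.
have q0 : 0 <= q by rewrite ltW// (lt_trans ltr01).
have mono (u v : R) : 0 <= u -> u <= v -> u `^ q <= v `^ q.
  by move=> u0 uv; apply: ge0_ler_powR; rewrite ?nnegrE// (le_trans u0).
have mpow c A : measurable_fun A (fun y => (`|F y - c| `^ q)%:E).
  exact: measurable_powR_norm.
have ae_int_le c (d : R) l x : 0 <= d ->
    {ae mu, forall y, cell l x y -> `|F y - c| <= d} ->
    (\int[mu]_(y in cell l x) (`|F y - c| `^ q)%:E <= (d `^ q * mass (cell l x))%:E)%E.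
  move=> d0 Fd; have mc : measurable (cell l x) by exact: measurable_cell.
  rewrite EFinM -(mu_cell D_dyadic mu_D) -integral_cst//.
  apply: ae_ge0_le_integral => //.
  - by move=> y _; rewrite lee_fin powR_ge0.
  - by apply: filterS Fd => y Fy xy; rewrite lee_fin; apply: mono => //; exact: Fy.
have norm_le : (lipschitz_norm D mu q alpha F <= M%:E)%E.
  apply/(lipschitz_norm_le n_gt0 D_dyadic mu_D) => // l x.
  have [c cP] := F_dec l x.
  have [Phii Phi0] := Phi_int l x.
  have mc : measurable (cell l x) by exact: measurable_cell.
  have avgE : average mu (cell l x) F = c.
    rewrite /average (_ : \int[mu]_(y in cell l x) F y = c * mass (cell l x)).
      by rewrite mulrC mulfK// gt_eqF// mass_gt0.
    transitivity (\int[mu]_(y in cell l x) (cst c y + Phi l y)).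
      rewrite /Rintegral; congr fine; apply: ae_eq_integral => //.
      - by apply/measurable_EFinP; exact: measurable_funS mF.
      - apply/measurable_EFinP; apply: measurable_funD => //.
        by apply/measurable_EFinP; case/integrableP : Phii.
      - by apply: filterS cP => y yP xy; rewrite yP.
    rewrite RintegralD//; first by rewrite Phi0 addr0 Rintegral_cst.
    exact: integrable_cst_cell.
  rewrite /oscillation avgE; apply: ae_int_le; first by rewrite mulr_ge0// powR_ge0.
  apply: filterS cP => y yP xy.
  have lxy : cell l x y by apply: cell_sub xy => //; lia.
  by rewrite yP// addrC addKr -(cell_eq D_dyadic xy).
split => //; split; last by apply: le_lt_trans norm_le _; rewrite ltry.
apply/(Lq_locP D_dyadic); split=> // l x.
have [c cP] := F_dec l x.
pose d := `|c| + B * mass (cell l x) `^ alpha.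
have := @ae_int_le 0 d l x; under eq_integral do rewrite subr0.
move=> H; apply: (le_lt_trans (H _ _)); last by rewrite ltry.
  by rewrite addr_ge0// mulr_ge0// powR_ge0.
apply: filterS cP => y yP xy; rewrite subr0 yP//.
apply: (le_trans (ler_normD _ _)); rewrite lerD2l -(cell_eq D_dyadic xy).
exact: Phi_le.
Qed.

End image_norm.

Theorem theorem2 (R : realType) (n : nat) (n_gt0 : (0 < n)%N)
    (D : int -> set (set (n.-tuple R))) (D_dyadic : dyadic_system D)
    (mu : {measure set (n.-tuple R) -> \bar R}) (mu_D : dyadic_measure D mu)
    (h : haar_family R n) (h_haar : haar_system D mu h)
    (mu_balanced : balanced D mu h)
    (q alpha : R) (q_gt1 : 1 < q) (alpha_gt0 : 0 < alpha)
    (r s : nat)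
    (a : set (n.-tuple R) -> set (n.-tuple R) -> set (n.-tuple R) -> R)
    (T_bounded : L2_bounded mu (haar_shift D mu h r s a)) :
  exists C : R, forall f : n.-tuple R -> R,
    lipschitz_space D mu q alpha f ->
    (exists F : n.-tuple R -> R, haar_shift_image D mu h r s a f F) /\
    (forall F : n.-tuple R -> R, haar_shift_image D mu h r s a f F ->
      lipschitz_space D mu q alpha F /\
      (lipschitz_norm D mu q alpha F <= C%:E * lipschitz_norm D mu q alpha f)%E).
Proof.
have [A A0 a_le] := coefficients_bounded n_gt0 D_dyadic mu_D h_haar T_bounded.
have [K [K0 h_le]] := balanced_descendants n_gt0 D_dyadic mu_D h_haar mu_balanced r s.
have G0 := @gen_bound_ge0 R n alpha r A K A0 K0.
set G := gen_bound _ _ _ _ in G0.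
have T0 := tele_const_gt0 alpha_gt0.
exists (G * 2 * (1 + tele_const alpha)) => f f_lip.
have [N NE] : exists N : R, lipschitz_norm D mu q alpha f = N%:E.
  have := lipschitz_norm_ge0 D_dyadic mu q alpha f; have [_] := f_lip.
  by case: lipschitz_norm => // N _ _; exists N.
have N0 : 0 <= N by rewrite -lee_fin -NE; exact: lipschitz_norm_ge0.
have L0 : 0 <= 2 * N by rewrite mulr_ge0.
have [f_int f_jumps] := lipschitz_jumps n_gt0 D_dyadic mu_D q_gt1 f_lip NE.
split.
  eexists; exact: (haar_shift_image_exists n_gt0 D_dyadic mu_D h_haar A0 a_le
    alpha_gt0 K0 h_le L0 f_int f_jumps).
move=> F F_im; rewrite NE -EFinM.
have -> : G * 2 * (1 + tele_const alpha) * N = G * (2 * N) * (1 + tele_const alpha).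
  by ring.
apply: (@lipschitz_of_decomposition R n n_gt0 D D_dyadic mu mu_D q alpha q_gt1 F
  (fine_part D mu h r s a f) (G * (2 * N) * tele_const alpha)).
- by case: F_im.
- by apply: mulr_ge0; [exact: mulr_ge0 | exact: ltW].
- by apply: mulr_ge0; [exact: mulr_ge0 | rewrite addr_ge0// ltW].
- move=> l x; exact: (haar_shift_image_fine n_gt0 D_dyadic mu_D h_haar A0 a_le
    alpha_gt0 K0 h_le L0 f_int f_jumps).
- move=> l x; exact: (Rintegral_fine_part n_gt0 D_dyadic mu_D h_haar alpha_gt0
    A0 K0 a_le h_le L0 f_int f_jumps).
- move=> l x; exact: (fine_part_le n_gt0 D_dyadic mu_D h_haar alpha_gt0
    A0 K0 a_le h_le L0 f_int f_jumps).
- move=> l x; exact: (fine_part_child_le n_gt0 D_dyadic mu_D h_haar alpha_gt0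
    A0 K0 a_le h_le L0 f_int f_jumps).
Qed.
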